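(* Let $c>1$ be a real number which is not an integer. Then for every multiplicative function $f:\mathbb N\to\mathbb C$ with $|f(n)|\le1$ for all $n$, and for every $\alpha\in\mathbb Q\setminus\mathbb Z$, \[\sum_{n<N}f(n)\,e\bigl(\alpha\lfloor n^c\rfloor\bigr)=o(N)\qquad(N\to\infty).\]
   Context: $e(u)=\exp(2\pi i u)$ for real $u$. *)

(* Defs.v *)
From Stdlib Require Import Reals ZArith Arith.
From Coquelicot Require Import Coquelicot.
Open Scope R_scope.

Definition e (u : R) : C := (cos (2 * PI * u), sin (2 * PI * u)).

Definition floor (x : R) : Z := Int_part x.

Definition multiplicative (f : nat -> C) : Prop :=
  f 1%nat = 1%C /\
  forall m n : nat, (0 < m)%nat -> (0 < n)%nat -> Nat.gcd m n = 1%nat ->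
    f (m * n)%nat = (f m * f n)%C.

Definition is_rational (x : R) : Prop :=
  exists p q : Z, q <> 0%Z /\ x = IZR p / IZR q.

Definition is_integer (x : R) : Prop := exists k : Z, x = IZR k.

Definition S (f : nat -> C) (alpha c : R) (N : nat) : C :=
  sum_n_m (fun n => (f n * e (alpha * IZR (floor (Rpower (INR n) c))))%C)
    1 (N - 1).

(* Main.v *)
Require Import Defs.
From Stdlib Require Import Reals ZArith Arith.
From Coquelicot Require Import Coquelicot.
From Stdlib Require Import Lra Lia List ClassicalEpsilon.
Open Scope R_scope.

(** Write e(alpha floor(y)) = e(alpha y) phi(y) with phi 1-periodic and continuous away from the
    integers.  A discrete Fejer mean replaces phi by a trigonometric polynomial; the error is small
    unless n^c is close to an integer, which is rare because n^c is equidistributed mod 1.  The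
    sum becomes a finite combination of sums of f(n) e(theta n^c) with theta in alpha + Z, so
    theta <> 0.  By the Daboussi-Katai criterion such a sum is o(N) as soon as
    sum_n e(theta (q^c - p^c) n^c) = o(N) for all primes p < q.  The latter follows from van der
    Corput's difference lemma: after floor(c) differencings the phase behaves like n^s with
    0 < s < 1, and such a slowly varying sum is telescoping up to o(1) per term. *)

(** One mean-square inequality, [almost_orthogonal], does three jobs: its vectors are shifts in van
    der Corput's lemma, dilates by primes in the Daboussi-Katai criterion, and harmonics e(j x_n)
    when points near integers are counted. Each time the off-diagonal correlations are o(N), so that
    only the diagonal matters. Cauchy-Schwarz enters as AM-GM with an explicit parameter, which is
    why scales come as an integer K together with K^2. Since c is not an integer, no factor of
    c(c-1)(c-2)... vanishes, and floor(c) differencings leave an exponent strictly between 0 and 1: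
    the phase is still unbounded, but its increments tend to 0. Fejer weights are nonnegative with
    sum one. Hence the error stays at most 2 even at the jumps of phi, where no good approximation
    is possible, and sampling phi at the points l/J requires no integrals. *)

(** * Finite sums over lists *)

Definition Rsum {A : Type} (l : list A) (f : A -> R) : R :=
  fold_right (fun a s => f a + s) 0 l.

Definition Csum {A : Type} (l : list A) (f : A -> C) : C :=
  fold_right (fun a s => f a + s)%C 0%C l.

Lemma Rsum_ext {A} (l : list A) f g :
  (forall a, In a l -> f a = g a) -> Rsum l f = Rsum l g.
Proof.
  induction l as [|a l IH]; simpl; intros H; [easy|].
  rewrite H by now left. rewrite IH; [easy|]. intros; apply H; now right.
Qed.

Lemma Csum_ext {A} (l : list A) f g :
  (forall a, In a l -> f a = g a) -> Csum l f = Csum l g.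
Proof.
  induction l as [|a l IH]; simpl; intros H; [easy|].
  rewrite H by now left. rewrite IH; [easy|]. intros; apply H; now right.
Qed.

Lemma Rsum_le {A} (l : list A) f g :
  (forall a, In a l -> f a <= g a) -> Rsum l f <= Rsum l g.
Proof.
  induction l as [|a l IH]; simpl; intros H; [lra|].
  apply Rplus_le_compat; [apply H; now left|]. apply IH; intros; apply H; now right.
Qed.

Lemma Rsum_plus {A} (l : list A) f g :
  Rsum l (fun a => f a + g a) = Rsum l f + Rsum l g.
Proof. induction l as [|a l IH]; simpl; [lra|]. rewrite IH; lra. Qed.

Lemma Csum_plus {A} (l : list A) f g :
  Csum l (fun a => f a + g a)%C = (Csum l f + Csum l g)%C.
Proof. induction l as [|a l IH]; simpl; [ring|]. rewrite IH; ring. Qed.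

Lemma Csum_minus {A} (l : list A) f g :
  Csum l (fun a => f a - g a)%C = (Csum l f - Csum l g)%C.
Proof. induction l as [|a l IH]; simpl; [ring|]. rewrite IH; ring. Qed.

Lemma Rsum_scal {A} (l : list A) k f :
  Rsum l (fun a => k * f a) = k * Rsum l f.
Proof. induction l as [|a l IH]; simpl; [lra|]. rewrite IH; lra. Qed.

Lemma Csum_scal {A} (l : list A) k f :
  Csum l (fun a => k * f a)%C = (k * Csum l f)%C.
Proof. induction l as [|a l IH]; simpl; [ring|]. rewrite IH; ring. Qed.

Lemma Rsum_const {A} (l : list A) k :
  Rsum l (fun _ => k) = INR (length l) * k.
Proof. induction l as [|a l IH]; [simpl; lra|]. cbn [Rsum fold_right length].
  fold (Rsum l (fun _ => k)). rewrite IH, S_INR; lra. Qed.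

Lemma Csum_0 {A} (l : list A) : Csum l (fun _ => 0%C) = 0%C.
Proof. induction l as [|a l IH]; simpl; [easy|]. rewrite IH; ring. Qed.

Lemma Rsum_ge0 {A} (l : list A) f :
  (forall a, In a l -> 0 <= f a) -> 0 <= Rsum l f.
Proof.
  intros H. replace 0 with (Rsum l (fun _ => 0)) by (rewrite Rsum_const; lra).
  now apply Rsum_le.
Qed.

Lemma Rsum_app {A} (l l' : list A) f : Rsum (l ++ l') f = Rsum l f + Rsum l' f.
Proof. induction l as [|a l IH]; simpl; [lra|]. rewrite IH; lra. Qed.

Lemma Csum_app {A} (l l' : list A) f : Csum (l ++ l') f = (Csum l f + Csum l' f)%C.
Proof. induction l as [|a l IH]; simpl; [ring|]. rewrite IH; ring. Qed.

Lemma Rsum_switch {A B} (l : list A) (l' : list B) f :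
  Rsum l (fun a => Rsum l' (f a)) = Rsum l' (fun b => Rsum l (fun a => f a b)).
Proof.
  induction l as [|a l IH]; simpl; [rewrite Rsum_const; lra|].
  now rewrite IH, <- Rsum_plus.
Qed.

Lemma Csum_switch {A B} (l : list A) (l' : list B) f :
  Csum l (fun a => Csum l' (f a)) = Csum l' (fun b => Csum l (fun a => f a b)).
Proof.
  induction l as [|a l IH]; simpl; [now rewrite Csum_0|].
  now rewrite IH, <- Csum_plus.
Qed.

Lemma Csum_RtoC {A} (l : list A) f : Csum l (fun a => RtoC (f a)) = RtoC (Rsum l f).
Proof. induction l as [|a l IH]; simpl; [easy|]. now rewrite IH, RtoC_plus. Qed.

Lemma Cconj_Csum {A} (l : list A) f : Cconj (Csum l f) = Csum l (fun a => Cconj (f a)).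
Proof.
  induction l as [|a l IH]; simpl; [apply injective_projections; simpl; ring|].
  now rewrite Cplus_conj, IH.
Qed.

Lemma Cmod_Csum {A} (l : list A) f : Cmod (Csum l f) <= Rsum l (fun a => Cmod (f a)).
Proof.
  induction l as [|a l IH]; simpl; [rewrite Cmod_0; lra|].
  eapply Rle_trans; [apply Cmod_triangle|]. lra.
Qed.

Lemma Rsum_seq_S m n f : Rsum (seq m (Datatypes.S n)) f = Rsum (seq m n) f + f (m + n)%nat.
Proof. rewrite seq_S, Rsum_app; simpl; lra. Qed.

Lemma Csum_seq_S m n f :
  Csum (seq m (Datatypes.S n)) f = (Csum (seq m n) f + f (m + n)%nat)%C.
Proof. rewrite seq_S, Csum_app; simpl; ring. Qed.

Lemma Rsum_single (l : list nat) p v :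
  NoDup l -> In p l -> Rsum l (fun q => if Nat.eq_dec p q then v else 0) = v.
Proof.
  induction 1 as [|a l Ha Hl IH]; simpl; [easy|]. intros [->|Hp].
  - destruct (Nat.eq_dec p p); [|easy].
    rewrite (Rsum_ext l _ (fun _ => 0)), Rsum_const; [lra|].
    intros q Hq. destruct (Nat.eq_dec p q); [now subst|easy].
  - destruct (Nat.eq_dec p a); [now subst|]. rewrite IH by easy; lra.
Qed.

Lemma Cmod_minus_le (x y : C) : Cmod (x - y) <= Cmod x + Cmod y.
Proof. unfold Cminus. rewrite <- (Cmod_opp y). apply Cmod_triangle. Qed.

Lemma Cmod_minus_sym (x y : C) : Cmod (x - y) = Cmod (y - x).
Proof. rewrite <- Cmod_opp. f_equal; ring. Qed.

Lemma Cmod_sqr (z : C) : RtoC (Cmod z ^ 2) = (z * Cconj z)%C.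
Proof. exact (Cmod2_conj z). Qed.

(* AM-GM in place of Cauchy-Schwarz. *)
Lemma Rsum_le_squares {A} (l : list A) x t : 0 < t ->
  Rsum l x <= (t * INR (length l) + / t * Rsum l (fun a => x a ^ 2)) / 2.
Proof.
  intros Ht. replace (t * INR (length l)) with (Rsum l (fun _ => t))
    by (rewrite Rsum_const; ring).
  rewrite <- Rsum_scal, <- Rsum_plus. unfold Rdiv. rewrite Rmult_comm, <- Rsum_scal.
  apply Rsum_le; intros a _.
  assert (H : 0 <= / t * (x a - t) ^ 2).
  { apply Rmult_le_pos; [left; now apply Rinv_0_lt_compat|apply pow2_ge_0]. }
  replace (/ t * (x a - t) ^ 2) with (/ t * x a ^ 2 - 2 * x a + t) in H by (field; lra).
  lra.
Qed.

(** * Sublinear functions *)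

(* One-sided: only used for nonnegative functions and for upper bounds on an excess. *)
Definition sublinear (u : nat -> R) : Prop :=
  forall eps, 0 < eps -> eventually (fun N => u N <= eps * INR N).

Lemma sublinear_le u v : (forall N, u N <= v N) -> sublinear v -> sublinear u.
Proof.
  intros H Hv eps He. generalize (Hv eps He). apply filter_imp.
  intros N HN. specialize (H N). lra.
Qed.

Lemma sublinear_plus u v : sublinear u -> sublinear v -> sublinear (fun N => u N + v N).
Proof.
  intros Hu Hv eps He. assert (He2 : 0 < eps / 2) by lra.
  generalize (filter_and _ _ (Hu _ He2) (Hv _ He2)).
  apply filter_imp. intros N [H1 H2]. lra.
Qed.

Lemma sublinear_scal k u : 0 <= k -> sublinear u -> sublinear (fun N => k * u N).
Proof.
  intros Hk Hu eps He.
  assert (H : 0 < eps / (k + 1)) by (apply Rdiv_lt_0_compat; lra).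
  generalize (Hu _ H). apply filter_imp. intros N HN.
  apply Rle_trans with (k * (eps / (k + 1) * INR N)); [now apply Rmult_le_compat_l|].
  replace (eps * INR N) with ((k + 1) * (eps / (k + 1) * INR N)) by (field; lra).
  assert (0 <= eps / (k + 1) * INR N) by (apply Rmult_le_pos; [lra|apply pos_INR]).
  lra.
Qed.

Lemma sublinear_const k : sublinear (fun _ => k).
Proof.
  intros eps He. destruct (nfloor_ex (Rabs k / eps)) as [n [_ Hn]].
  { apply Rdiv_le_0_compat; [apply Rabs_pos|lra]. }
  exists (n + 1)%nat. intros N HN. apply le_INR in HN. rewrite plus_INR in HN. simpl in HN.
  apply Rle_trans with (Rabs k); [apply Rle_abs|].
  replace (Rabs k) with (eps * (Rabs k / eps)) by (field; lra).
  apply Rmult_le_compat_l; lra.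
Qed.

Lemma sublinear_Rsum {A} (l : list A) u :
  (forall a, In a l -> sublinear (u a)) -> sublinear (fun N => Rsum l (fun a => u a N)).
Proof.
  induction l as [|a l IH]; simpl; intros H; [apply sublinear_const|].
  apply sublinear_plus; [apply H; now left|apply IH; intros; apply H; now right].
Qed.

Lemma sublinear_div p u : sublinear u -> (0 < p)%nat -> sublinear (fun N => u (N / p)%nat).
Proof.
  intros Hu Hp eps He. destruct (Hu eps He) as [N0 H0].
  exists (N0 * p)%nat. intros N HN.
  apply Rle_trans with (eps * INR (N / p)).
  - apply H0. apply Nat.div_le_lower_bound; lia.
  - apply Rmult_le_compat_l; [lra|]. apply le_INR, Nat.Div0.div_le_upper_bound. nia.
Qed.

Lemma sublinear_cesaro (a : nat -> R) :
  (forall n, 0 <= a n) -> is_lim_seq a 0 ->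
  sublinear (fun N => Rsum (seq 1 N) a).
Proof.
  intros Ha Hl eps He. apply is_lim_seq_spec in Hl.
  destruct (Hl (mkposreal (eps / 2) ltac:(lra))) as [N0 H0]. simpl in H0.
  destruct (sublinear_const (Rsum (seq 1 N0) a) (eps / 2) ltac:(lra)) as [N1 H1].
  exists (N0 + N1)%nat. intros N HN.
  replace N with (N0 + (N - N0))%nat by lia.
  rewrite seq_app, Rsum_app.
  specialize (H1 (N0 + (N - N0))%nat ltac:(lia)).
  assert (H2 : Rsum (seq (1 + N0) (N - N0)) a <= Rsum (seq (1 + N0) (N - N0)) (fun _ => eps / 2)).
  { apply Rsum_le. intros n Hn. apply in_seq in Hn.
    specialize (H0 n ltac:(lia)). rewrite Rminus_0_r, Rabs_pos_eq in H0 by easy. lra. }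
  rewrite Rsum_const, length_seq in H2. rewrite plus_INR in *.
  assert (0 <= INR N0) by apply pos_INR. nra.
Qed.

(** * Almost orthogonality *)

(** Expand the square, exchange the sums, and apply the triangle inequality to the resulting
    correlations. *)
Lemma Rsum_Cmod_sqr_le {A B} (ns : list A) (l : list B) (z : B -> A -> C) :
  Rsum ns (fun n => Cmod (Csum l (fun i => z i n)) ^ 2) <=
  Rsum l (fun i => Rsum l (fun j => Cmod (Csum ns (fun n => z i n * Cconj (z j n))%C))).
Proof.
  set (T := Rsum ns _).
  assert (HT : RtoC T = Csum l (fun i => Csum l (fun j =>
            Csum ns (fun n => z i n * Cconj (z j n))%C))).
  { unfold T. rewrite <- Csum_RtoC.
    rewrite (Csum_ext ns _ (fun n => Csum l (fun i => Csum l (fun j => z i n * Cconj (z j n))%C))).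
    - rewrite Csum_switch. apply Csum_ext; intros i _. now rewrite Csum_switch.
    - intros n _. rewrite Cmod_sqr, Cconj_Csum.
      rewrite Cmult_comm, <- Csum_scal. apply Csum_ext; intros i _.
      rewrite Cmult_comm, <- Csum_scal. now apply Csum_ext. }
  apply Rle_trans with (Rabs T); [apply Rle_abs|].
  rewrite <- Cmod_R, HT. eapply Rle_trans; [apply Cmod_Csum|].
  apply Rsum_le; intros i _. apply Cmod_Csum.
Qed.

(** After the expansion each diagonal pair costs at most [d i * INR N], and the finitely many other
    pairs are sublinear; conjugation swaps [i] and [j], so one order suffices. The vectors may
    depend on [N], which lets the Katai argument truncate them at N/p. *)
Lemma almost_orthogonal (l : list nat) (z : nat -> nat -> nat -> C) (d : nat -> R) :
  NoDup l ->
  (forall i, In i l -> forall N, Rsum (seq 1 N) (fun n => Cmod (z N i n) ^ 2) <= d i * INR N) ->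
  (forall i j, In i l -> In j l -> (j < i)%nat -> sublinear (fun N =>
     Cmod (Csum (seq 1 N) (fun n => z N i n * Cconj (z N j n))%C))) ->
  sublinear (fun N => Rsum (seq 1 N) (fun n => Cmod (Csum l (fun i => z N i n)) ^ 2)
                      - Rsum l d * INR N).
Proof.
  intros Hl Hd Hc.
  set (E := fun i j N => Cmod (Csum (seq 1 N) (fun n => z N i n * Cconj (z N j n))%C)).
  set (E' := fun i j N => if Nat.eq_dec i j then 0 else E i j N).
  apply sublinear_le with (fun N => Rsum l (fun i => Rsum l (fun j => E' i j N))).
  - intros N.
    generalize (Rsum_Cmod_sqr_le (seq 1 N) l (z N)).
    assert (Rsum l (fun i => Rsum l (fun j => E i j N)) <=
            Rsum l (fun i => Rsum l (fun j => E' i j N)) + Rsum l d * INR N).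
    { rewrite (Rmult_comm (Rsum l d)), <- Rsum_scal, <- Rsum_plus.
      apply Rsum_le; intros i Hi.
      rewrite <- (Rsum_single l i (INR N * d i) Hl Hi), <- Rsum_plus.
      apply Rsum_le; intros j Hj. unfold E'. destruct (Nat.eq_dec i j) as [<-|_]; [|lra].
      unfold E. rewrite (Csum_ext _ _ (fun n => RtoC (Cmod (z N i n) ^ 2)))
        by (intros; now rewrite Cmod_sqr).
      rewrite Csum_RtoC, Cmod_R, Rabs_pos_eq by (apply Rsum_ge0; intros; apply pow2_ge_0).
      specialize (Hd i Hi N). lra. }
    unfold E in *. lra.
  - apply sublinear_Rsum; intros i Hi. apply sublinear_Rsum; intros j Hj.
    unfold E'. destruct (Nat.eq_dec i j) as [_|Hij]; [apply sublinear_const|].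
    destruct (Nat.lt_total i j) as [H|[H|H]]; [|easy|now apply Hc].
    apply sublinear_le with (2 := Hc j i Hj Hi H). intros N. right. unfold E.
    rewrite <- Cmod_conj, Cconj_Csum. f_equal. apply Csum_ext; intros n _.
    rewrite Cmult_conj, Cconj_conj. ring.
Qed.

(** * Van der Corput's difference lemma *)

(** Raising the shift by one exchanges a single end term of the sum for another, at a cost of at
    most 2. *)
Lemma Cmod_Csum_shift (g : nat -> C) j N : (forall n, Cmod (g n) <= 1) ->
  Cmod (Csum (seq 1 N) (fun n => g (n + j)%nat) - Csum (seq 1 N) g) <= 2 * INR j.
Proof.
  intros Hg. induction j as [|j IH].
  - rewrite (Csum_ext _ _ g) by (intros; f_equal; lia).
    replace (_ - _)%C with (RtoC 0) by ring. rewrite Cmod_0. simpl; lra.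
  - assert (H : (Csum (seq 1 N) (fun n => g (n + Datatypes.S j)%nat) -
                 Csum (seq 1 N) (fun n => g (n + j)%nat) =
                 g (1 + N + j)%nat - g (1 + j)%nat)%C).
    { clear. induction N as [|N IH]; [simpl; ring|].
      rewrite !Csum_seq_S.
      replace (1 + N + Datatypes.S j)%nat with (1 + Datatypes.S N + j)%nat by lia.
      match goal with |- (?a + ?b - (?c + ?d) = _)%C =>
        replace (a + b - (c + d))%C with ((a - c) + b - d)%C by ring end.
      rewrite IH. ring. }
    match type of H with (?a - ?b = _)%C =>
      replace (a - Csum (seq 1 N) g)%C with ((a - b) + (b - Csum (seq 1 N) g))%C by ring end.
    eapply Rle_trans; [apply Cmod_triangle|]. rewrite H, S_INR.
    generalize (Cmod_minus_le (g (1 + N + j)%nat) (g (1 + j)%nat)) (Hg (1 + N + j)%nat)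
      (Hg (1 + j)%nat). lra.
Qed.

Lemma Rsum_Cmod_sqr_le_INR (g : nat -> C) N : (forall n, Cmod (g n) <= 1) ->
  Rsum (seq 1 N) (fun n => Cmod (g n) ^ 2) <= 1 * INR N.
Proof.
  intros Hg. apply Rle_trans with (Rsum (seq 1 N) (fun _ => 1)).
  - apply Rsum_le; intros n _. generalize (Hg n) (Cmod_ge_0 (g n)). nra.
  - rewrite Rsum_const, length_seq; lra.
Qed.

Lemma nat_scale_ex eps : 0 < eps -> exists K : nat, (0 < K)%nat /\ / INR K <= eps.
Proof.
  intros He. destruct (nfloor_ex (/ eps)) as [K [_ HK]].
  { left. now apply Rinv_0_lt_compat. }
  exists (K + 1)%nat. split; [lia|]. rewrite plus_INR. simpl.
  rewrite <- (Rinv_inv eps). apply Rinv_le_contravar; [now apply Rinv_0_lt_compat|lra].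
Qed.

(** H times the sum equals the sum of the blocks [Z n] of length H, up to 2 H^2. Distinct shifts are
    almost orthogonal, so the blocks have mean square at most about H, and the original sum is at
    most about N / sqrt H. *)
Lemma van_der_corput (z : nat -> C) : (forall n, Cmod (z n) <= 1) ->
  (forall h, (0 < h)%nat -> sublinear (fun N =>
     Cmod (Csum (seq 1 N) (fun n => z (n + h)%nat * Cconj (z n))%C))) ->
  sublinear (fun N => Cmod (Csum (seq 1 N) z)).
Proof.
  intros Hz Hc eps He.
  assert (He2 : 0 < eps / 2) by lra.
  destruct (nat_scale_ex _ He2) as [K [HK HKe]].
  assert (HK0 : 0 < INR K) by now apply (lt_INR 0).
  (* A square, so that K = sqrt H, the typical size of a block, can serve as the AM-GM parameter. *)
  set (H := (K * K)%nat).
  assert (HH : INR H = INR K * INR K) by apply mult_INR.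
  assert (HH0 : 0 < INR H) by (rewrite HH; now apply Rmult_lt_0_compat).
  assert (HA : sublinear (fun N => Rsum (seq 1 N)
     (fun n => Cmod (Csum (seq 0 H) (fun i => z (n + i)%nat)) ^ 2)
                      - Rsum (seq 0 H) (fun _ => 1) * INR N)).
  { apply (almost_orthogonal (seq 0 H) (fun _ i n => z (n + i)%nat) (fun _ => 1)).
    - apply seq_NoDup.
    - intros i _ N. now apply (Rsum_Cmod_sqr_le_INR (fun n => z (n + i)%nat)).
    - intros i j _ _ Hij.
      (* The correlation of the shifts i and j is the correlation of lag i - j, translated by j. *)
      set (g := fun n => (z (n + (i - j))%nat * Cconj (z n))%C).
      apply sublinear_le with (fun N => Cmod (Csum (seq 1 N) g) + 2 * INR j).
      + intros N.
        rewrite (Csum_ext _ _ (fun n => g (n + j)%nat)).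
        2:{ intros n _. unfold g. now replace (n + j + (i - j))%nat with (n + i)%nat by lia. }
        assert (Hg : forall n, Cmod (g n) <= 1).
        { intros n. unfold g. rewrite Cmod_mult, Cmod_conj.
          rewrite <- (Rmult_1_r 1). apply Rmult_le_compat; auto using Cmod_ge_0. }
        generalize (Cmod_Csum_shift g j N Hg). intros H1.
        match type of H1 with Cmod (?a - ?b) <= _ =>
          generalize (Cmod_triangle (a - b) b); replace (a - b + b)%C with a by ring end.
        lra.
      + apply sublinear_plus; [apply Hc; lia|apply sublinear_const]. }
  rewrite Rsum_const, length_seq in HA.
  assert (HK2 : 0 <= / INR K / 2).
  { assert (0 < / INR K) by now apply Rinv_0_lt_compat. lra. }
  destruct (sublinear_plus _ _ (sublinear_scal _ _ HK2 HA)
     (sublinear_const (2 * (INR H * INR H))) (eps / 2 * INR H)) as [N0 H0].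
  { apply Rmult_lt_0_compat; easy. }
  exists N0. intros N HN. specialize (H0 N HN). cbv beta in H0.
  set (Z := fun n => Csum (seq 0 H) (fun i => z (n + i)%nat)) in *.
  assert (H1 : Cmod (RtoC (INR H) * Csum (seq 1 N) z) <= Cmod (Csum (seq 1 N) Z) + 2 * (INR H * INR H)).
  { replace (RtoC (INR H) * Csum (seq 1 N) z)%C with
      (Csum (seq 1 N) Z - Csum (seq 0 H) (fun i =>
          (Csum (seq 1 N) (fun n => z (n + i)%nat) - Csum (seq 1 N) z)))%C.
    - eapply Rle_trans; [apply Cmod_minus_le|]. apply Rplus_le_compat_l.
      eapply Rle_trans; [apply Cmod_Csum|].
      apply Rle_trans with (Rsum (seq 0 H) (fun _ => 2 * INR H)).
      + apply Rsum_le. intros i Hi. apply in_seq in Hi.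
        apply Rle_trans with (2 * INR i); [now apply Cmod_Csum_shift|].
        apply Rmult_le_compat_l; [lra|]. apply le_INR; lia.
      + rewrite Rsum_const, length_seq. lra.
    - rewrite Csum_minus. unfold Z. rewrite Csum_switch.
      rewrite (Csum_ext (seq 0 H) (fun _ => Csum (seq 1 N) z) (fun _ => Csum (seq 1 N) z * RtoC 1)%C)
        by (intros; ring).
      rewrite Csum_scal, Csum_RtoC, Rsum_const, length_seq, Rmult_1_r. ring. }
  rewrite Cmod_mult, Cmod_R, Rabs_pos_eq in H1 by apply pos_INR.
  assert (H2 := Cmod_Csum (seq 1 N) Z).
  assert (H3 := Rsum_le_squares (seq 1 N) (fun n => Cmod (Z n)) (INR K) HK0).
  rewrite length_seq in H3.
  set (Q := Rsum (seq 1 N) (fun n => Cmod (Z n) ^ 2)) in *.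
  change (/ INR K / 2 * (Q - INR H * 1 * INR N) + 2 * (INR H * INR H)
          <= eps / 2 * INR H * INR N) in H0.
  apply Rmult_le_reg_l with (INR H); [easy|].
  assert (H4 : / INR K / 2 * (INR H * 1 * INR N) = INR K * INR N / 2) by (rewrite HH; field; lra).
  assert (H5 : INR K * INR N <= eps / 2 * (INR H * INR N)).
  { replace (INR K * INR N) with (/ INR K * (INR H * INR N)) by (rewrite HH; field; lra).
    apply Rmult_le_compat_r; [|easy]. apply Rmult_le_pos; apply pos_INR. }
  clearbody Q. lra.
Qed.

(** * The additive character *)

Lemma e_plus u v : e (u + v) = (e u * e v)%C.
Proof.
  unfold e. rewrite Rmult_plus_distr_l, cos_plus, sin_plus.
  apply injective_projections; simpl; ring.
Qed.

Lemma Cmod_e u : Cmod (e u) = 1.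
Proof.
  unfold Cmod, e; simpl fst; simpl snd. rewrite <- !Rsqr_pow2, Rplus_comm, sin2_cos2.
  apply sqrt_1.
Qed.

Lemma Cconj_e u : Cconj (e u) = e (- u).
Proof.
  unfold Cconj, e; simpl. rewrite Ropp_mult_distr_r_reverse, cos_neg, sin_neg. easy.
Qed.

Lemma e_0 : e 0 = 1%C.
Proof. unfold e. rewrite Rmult_0_r, cos_0, sin_0. easy. Qed.

Lemma e_nat n : e (INR n) = 1%C.
Proof.
  unfold e. rewrite (Rmult_comm (2 * PI)).
  replace (INR n * (2 * PI)) with (0 + 2 * INR n * PI) by ring.
  rewrite cos_period, sin_period, cos_0, sin_0. easy.
Qed.

Lemma e_Z k : e (IZR k) = 1%C.
Proof.
  destruct (Z_le_gt_dec 0 k) as [Hk|Hk].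
  - rewrite <- (Z2Nat.id k Hk), <- INR_IZR_INZ. apply e_nat.
  - assert (H := e_nat (Z.to_nat (- k))).
    rewrite INR_IZR_INZ, Z2Nat.id, opp_IZR in H by lia.
    rewrite <- (Cconj_conj (e (IZR k))), Cconj_e, H.
    apply injective_projections; simpl; ring.
Qed.

Lemma sin_abs_le x : Rabs (sin x) <= Rabs x.
Proof.
  destruct (Req_dec x 0) as [->|Hx]; [rewrite sin_0; lra|].
  destruct (Rlt_le_dec 0 x) as [H|H].
  - rewrite (Rabs_pos_eq x) by lra. apply Rabs_le. split; [|left; now apply sin_lt_x].
    destruct (Rle_lt_dec x PI) as [H1|H1].
    + generalize (sin_ge_0 x (Rlt_le _ _ H) H1). lra.
    + generalize (SIN_bound x) PI2_3_2. lra.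
  - assert (Hx' : 0 < - x) by lra.
    rewrite (Rabs_left x) by lra. rewrite <- (Rabs_Ropp (sin x)), <- sin_neg.
    apply Rabs_le. split; [|left; now apply sin_lt_x].
    destruct (Rle_lt_dec (- x) PI) as [H1|H1].
    + generalize (sin_ge_0 (- x) (Rlt_le _ _ Hx') H1). lra.
    + generalize (SIN_bound (- x)) PI2_3_2. lra.
Qed.

Lemma cos_one_minus x : 1 - cos x = 2 * sin (x / 2) ^ 2.
Proof.
  replace (cos x) with (cos (2 * (x / 2))) by (f_equal; field).
  rewrite cos_2a_sin. ring.
Qed.

Lemma Cmod_e_minus_1 u : Cmod (e u - 1) = 2 * Rabs (sin (PI * u)).
Proof.
  rewrite <- (Rabs_pos_eq 2) at 1 by lra. rewrite <- Rabs_mult, <- sqrt_Rsqr_abs.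
  unfold Cmod, e. f_equal. simpl. rewrite !Rmult_1_r.
  generalize (cos_one_minus (2 * PI * u)) (sin2_cos2 (2 * PI * u)).
  replace (2 * PI * u / 2) with (PI * u) by field. unfold Rsqr. intros H1 H2.
  replace (sin (PI * u) * sin (PI * u)) with ((1 - cos (2 * PI * u)) / 2); nra.
Qed.

Lemma Cmod_e_minus u v : Cmod (e u - e v) <= 2 * PI * Rabs (u - v).
Proof.
  replace (e u - e v)%C with (e v * (e (u - v) - 1))%C.
  - rewrite Cmod_mult, Cmod_e, Cmod_e_minus_1, Rmult_1_l, Rmult_assoc.
    apply Rmult_le_compat_l; [lra|]. eapply Rle_trans; [apply sin_abs_le|].
    rewrite Rabs_mult, (Rabs_pos_eq PI); [lra|]. left; apply PI_RGT_0.
  - replace u with (v + (u - v)) at 2 by ring. rewrite e_plus. ring.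
Qed.

(** Mean value theorem: the derivative cos y - 1 = -2 sin(y/2)^2 is at most |y| in modulus. *)
Lemma sin_minus_id_le x : Rabs (sin x - x) <= x ^ 2.
Proof.
  destruct (MVT_gen (fun y => sin y - y) 0 x (fun y => cos y - 1)) as [y [Hy H]].
  - intros y _. auto_derive; [easy|ring].
  - intros y _. apply continuity_pt_minus; [apply continuity_sin|apply continuity_pt_id].
  - rewrite sin_0, !Rminus_0_r in H. rewrite H, Rabs_mult.
    replace (x ^ 2) with (Rabs x * Rabs x) by (rewrite <- Rsqr_pow2, Rsqr_abs; easy).
    apply Rmult_le_compat_r; [apply Rabs_pos|].
    rewrite Rabs_minus_sym, cos_one_minus, Rabs_pos_eq by nra.
    assert (Hyx : Rabs y <= Rabs x).
    { destruct (Rle_lt_dec 0 x) as [H1|H1];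
        [rewrite Rmin_left, Rmax_right in Hy by lra; rewrite (Rabs_pos_eq x), (Rabs_pos_eq y); lra|].
      rewrite Rmin_right, Rmax_left in Hy by lra. rewrite (Rabs_left1 x), (Rabs_left1 y); lra. }
    generalize (sin_abs_le (y / 2)) (SIN_bound (y / 2)) (Rabs_pos (sin (y / 2))).
    unfold Rdiv at 2. rewrite Rabs_mult, (Rabs_pos_eq (/ 2)) by lra.
    intros H1 H2 H3. rewrite <- Rsqr_pow2, Rsqr_abs. unfold Rsqr.
    assert (Rabs (sin (y / 2)) <= 1) by now apply Rabs_le. nra.
Qed.

Lemma Cmod_le_plus (z : C) : Cmod z <= Rabs (fst z) + Rabs (snd z).
Proof.
  destruct z as [a b]. replace (a, b) with (RtoC a + Ci * RtoC b)%C
    by (apply injective_projections; simpl; ring).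
  eapply Rle_trans; [apply Cmod_triangle|]. rewrite Cmod_mult, !Cmod_R.
  rewrite Cmod_Ci. simpl. right; f_equal; [f_equal; ring|].
  rewrite Rmult_1_l. f_equal; ring.
Qed.

Lemma Cmod_e_second_order u :
  Cmod (e u - 1 - RtoC (2 * PI * u) * Ci) <= 2 * (2 * PI * u) ^ 2.
Proof.
  set (x := 2 * PI * u). eapply Rle_trans; [apply Cmod_le_plus|].
  unfold e; simpl. fold x.
  replace (cos x + - (1) + - (x * 0 - 0 * 1)) with (- (1 - cos x)) by ring.
  replace (sin x + - 0 + - (x * 1 + 0 * 0)) with (sin x - x) by ring.
  generalize (sin_minus_id_le x). rewrite Rabs_Ropp, cos_one_minus.
  rewrite (Rabs_pos_eq (2 * _)) by nra.
  generalize (sin_abs_le (x / 2)) (Rabs_pos (sin (x / 2))). intros H1 H2 H3.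
  assert (H4 : sin (x / 2) ^ 2 <= (x / 2) ^ 2).
  { rewrite <- (pow2_abs (sin _)), <- (pow2_abs (x / 2)). apply pow_incr. lra. }
  replace ((x / 2) ^ 2) with (x ^ 2 / 4) in H4 by field.
  generalize (pow2_ge_0 x). lra.
Qed.

(** * Exponential sums with slowly varying phase *)

(* Approximately e(g(n)) = (u(n+1) - u(n)) / (2 pi i gamma) for u(n) = w(n) e(g(n)). *)
Lemma slow_phase (g w : nat -> R) (gamma : R) : gamma <> 0 ->
  is_lim_seq (fun n => w n * (g (n + 1)%nat - g n)) gamma ->
  is_lim_seq (fun n => w (n + 1)%nat - w n) 0 ->
  is_lim_seq (fun n => g (n + 1)%nat - g n) 0 ->
  sublinear (fun N => Cmod (Csum (seq 1 N) (fun n => e (g n)))).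
Proof.
  intros Hg H1 H2 H3.
  set (dw := fun n => w (n + 1)%nat - w n) in *.
  set (d := fun n => g (n + 1)%nat - g n) in *.
  (* Error per term. One |dw| comes from the increment of the weight in u, the other pays for the
     boundary term w(N+1); 8 pi^2 = 2 (2 pi)^2 is the second-order remainder of e; the last term
     replaces w d by its limit gamma. *)
  set (a := fun n => 2 * Rabs (dw n) + 8 * PI ^ 2 * Rabs ((w n * d n) * d n)
                     + 2 * PI * Rabs (w n * d n - gamma)).
  set (kap := (RtoC (2 * PI * gamma) * Ci)%C).
  assert (Hpi := PI_RGT_0).
  assert (Ha0 : forall n, 0 <= a n).
  { intros n. unfold a. generalize (Rabs_pos (dw n)) (Rabs_pos ((w n * d n) * d n))
      (Rabs_pos (w n * d n - gamma)). intros. assert (0 <= 8 * PI ^ 2) by nra.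
    assert (0 <= 8 * PI ^ 2 * Rabs ((w n * d n) * d n)) by now apply Rmult_le_pos.
    nra. }
  assert (Ha : is_lim_seq a 0).
  { assert (L1 : is_lim_seq (fun n => Rabs (dw n)) 0) by now apply (proj1 (is_lim_seq_abs_0 _)).
    assert (L2 : is_lim_seq (fun n => Rabs ((w n * d n) * d n)) 0).
    { apply (proj1 (is_lim_seq_abs_0 _)). replace 0 with (gamma * 0) by ring.
      now apply is_lim_seq_mult'. }
    assert (L3 : is_lim_seq (fun n => Rabs (w n * d n - gamma)) 0).
    { apply (proj1 (is_lim_seq_abs_0 _)). replace 0 with (gamma - gamma) by ring.
      apply is_lim_seq_minus'; [easy|apply is_lim_seq_const]. }
    unfold a. replace 0 with (2 * 0 + 8 * PI ^ 2 * 0 + 2 * PI * 0) by ring.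
    apply is_lim_seq_plus'; [apply is_lim_seq_plus'|].
    - apply (is_lim_seq_scal_l _ 2 0); easy.
    - apply (is_lim_seq_scal_l _ (8 * PI ^ 2) 0); easy.
    - apply (is_lim_seq_scal_l _ (2 * PI) 0); easy. }
  assert (Hk : Cmod kap = 2 * PI * Rabs gamma).
  { unfold kap. rewrite Cmod_mult, Cmod_R, !Rabs_mult, (Rabs_pos_eq 2), (Rabs_pos_eq PI) by lra.
    rewrite Cmod_Ci. ring. }
  assert (Hk0 : 0 < Cmod kap).
  { rewrite Hk. generalize (Rabs_pos_lt _ Hg). nra. }
  set (u := fun n => (RtoC (w n) * e (g n))%C).
  assert (Hstep : forall n, Cmod (kap * e (g n) - (u (n + 1)%nat - u n)) <= a n - Rabs (dw n)).
  { intros n. unfold u.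
    replace (g (n + 1)%nat) with (g n + d n) by (unfold d; ring).
    replace (w (n + 1)%nat) with (w n + dw n) by (unfold dw; ring).
    rewrite e_plus, RtoC_plus.
    match goal with |- Cmod ?t <= _ => replace t with
      (- (RtoC (dw n) * (e (g n) * e (d n))) - e (g n) * (RtoC (w n) *
        (e (d n) - 1 - RtoC (2 * PI * d n) * Ci)
         + RtoC (2 * PI) * RtoC (w n * d n - gamma) * Ci))%C end.
    2:{ unfold kap. rewrite !RtoC_mult, !RtoC_minus, !RtoC_mult. ring. }
    eapply Rle_trans; [apply Cmod_minus_le|].
    rewrite Cmod_opp, !Cmod_mult, !Cmod_e, Cmod_R.
    assert (Cmod (RtoC (w n) * (e (d n) - 1 - RtoC (2 * PI * d n) * Ci)
         + RtoC (2 * PI) * RtoC (w n * d n - gamma) * Ci) <=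
         8 * PI ^ 2 * Rabs ((w n * d n) * d n) + 2 * PI * Rabs (w n * d n - gamma)).
    { eapply Rle_trans; [apply Cmod_triangle|]. apply Rplus_le_compat.
      - rewrite Cmod_mult, Cmod_R.
        eapply Rle_trans; [apply Rmult_le_compat_l;
          [apply Rabs_pos|apply Cmod_e_second_order]|].
        right. rewrite !Rabs_mult. rewrite <- (pow2_abs (2 * PI * d n)).
        rewrite !Rabs_mult, (Rabs_pos_eq 2), (Rabs_pos_eq PI) by lra. ring.
      - rewrite !Cmod_mult, !Cmod_R, (Rabs_pos_eq (2 * PI)) by nra.
        rewrite Cmod_Ci. lra. }
    unfold a. lra. }
  assert (Htel : forall N, Csum (seq 1 N) (fun n => u (n + 1)%nat - u n)%C
                           = (u (N + 1)%nat - u 1%nat)%C).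
  { induction N as [|N IH]; [simpl; ring|]. rewrite Csum_seq_S, IH.
    replace (1 + N)%nat with (N + 1)%nat by lia.
    replace (Datatypes.S N + 1)%nat with (N + 1 + 1)%nat by lia. ring. }
  assert (Hw : forall N, Rabs (w (N + 1)%nat) <= Rabs (w 1%nat) + Rsum (seq 1 N) (fun n => Rabs (dw n))).
  { induction N as [|N IH]; [simpl; lra|]. rewrite Rsum_seq_S.
    replace (1 + N)%nat with (N + 1)%nat by lia.
    replace (Datatypes.S N + 1)%nat with (N + 1 + 1)%nat by lia.
    replace (w (N + 1 + 1)%nat) with (w (N + 1)%nat + dw (N + 1)%nat) by (unfold dw; ring).
    generalize (Rabs_triang (w (N + 1)%nat) (dw (N + 1)%nat)). lra. }
  assert (Hu : forall n, Cmod (u n) = Rabs (w n)).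
  { intros n. unfold u. rewrite Cmod_mult, Cmod_e, Cmod_R. ring. }
  apply sublinear_le with
    (fun N => / Cmod kap * (Rsum (seq 1 N) a + 2 * Rabs (w 1%nat))).
  - intros N. apply Rmult_le_reg_l with (1 := Hk0).
    rewrite <- Rmult_assoc, Rinv_r, Rmult_1_l by lra. rewrite <- Cmod_mult, <- Csum_scal.
    replace (Csum (seq 1 N) (fun n => kap * e (g n))%C) with
      (Csum (seq 1 N) (fun n => kap * e (g n) - (u (n + 1)%nat - u n))%C
        + (u (N + 1)%nat - u 1%nat))%C by (rewrite <- Htel, Csum_minus; ring).
    eapply Rle_trans; [apply Cmod_triangle|].
    generalize (Cmod_minus_le (u (N + 1)%nat) (u 1%nat)). rewrite !Hu.
    generalize (Hw N).
    assert (Cmod (Csum (seq 1 N) (fun n => kap * e (g n) - (u (n + 1)%nat - u n))%C)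
            + Rsum (seq 1 N) (fun n => Rabs (dw n)) <= Rsum (seq 1 N) a).
    { apply Rle_trans with (Rsum (seq 1 N) (fun n => (a n - Rabs (dw n)) + Rabs (dw n))).
      - rewrite Rsum_plus. apply Rplus_le_compat_r.
        eapply Rle_trans; [apply Cmod_Csum|]. apply Rsum_le; intros; apply Hstep.
      - apply Rsum_le; intros; lra. }
    lra.
  - apply sublinear_scal; [left; now apply Rinv_0_lt_compat|].
    apply sublinear_plus; [now apply sublinear_cesaro|apply sublinear_const].
Qed.

(** * Iterated differences of powers *)

Fixpoint pdiff (hs : list nat) (p x : R) : R :=
  match hs with
  | nil => Rpower x p
  | cons h hs => pdiff hs p (x + INR h) - pdiff hs p x
  end.

(** The product of the steps times the falling factorial p(p-1)...(p-r+1), r being the number of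
    steps: the leading coefficient of the iterated difference of x^p. *)
Fixpoint pcoef (hs : list nat) (p : R) : R :=
  match hs with
  | nil => 1
  | cons h hs => INR h * p * pcoef hs (p - 1)
  end.

(** Differencing commutes with differentiation, so the exponent drops by one and the steps stay. *)
Lemma derivable_pt_lim_pdiff hs p x : 0 < x ->
  derivable_pt_lim (pdiff hs p) x (p * pdiff hs (p - 1) x).
Proof.
  revert x; induction hs as [|h hs IH]; intros x Hx; simpl.
  - now apply derivable_pt_lim_power.
  - rewrite Rmult_minus_distr_l.
    apply (derivable_pt_lim_minus (fun y => pdiff hs p (y + INR h)) (pdiff hs p)); [|now apply IH].
    rewrite <- (Rmult_1_r (p * _)).
    apply (derivable_pt_lim_comp (fun y => y + INR h) (pdiff hs p)).
    + apply is_derive_Reals. auto_derive; [easy|ring].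
    + apply IH. generalize (pos_INR h). lra.
Qed.

(** The mean value theorem trades the outermost difference for a factor h p and an exponent lowered
    by one; each use moves the point by at most its own step. *)
Lemma pdiff_mvt hs p x : 0 < x -> (forall h, In h hs -> (0 < h)%nat) ->
  exists xi, x <= xi <= x + INR (list_sum hs) /\
    pdiff hs p x = pcoef hs p * Rpower xi (p - INR (length hs)).
Proof.
  revert p x; induction hs as [|h hs IH]; intros p x Hx Hh.
  - exists x. simpl. rewrite Rminus_0_r. split; [lra|ring].
  - assert (Hh0 : 0 < INR h) by (apply (lt_INR 0), Hh; now left).
    destruct (MVT_cor2 (pdiff hs p) (fun y => p * pdiff hs (p - 1) y) x (x + INR h))
      as [y [Hy1 Hy2]]; [lra|intros; apply derivable_pt_lim_pdiff; lra|].
    destruct (IH (p - 1) y) as [xi [Hxi1 Hxi2]]; [lra|intros; apply Hh; now right|].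
    exists xi. change (list_sum (h :: hs)) with (h + list_sum hs)%nat.
    change (length (h :: hs)) with (Datatypes.S (length hs)).
    rewrite plus_INR, S_INR. split; [lra|]. simpl pdiff; simpl pcoef.
    rewrite Hy1, Hxi2. replace (p - 1 - INR (length hs)) with (p - (INR (length hs) + 1)) by ring.
    ring.
Qed.

Lemma pcoef_neq0 hs p : ~ is_integer p -> (forall h, In h hs -> (0 < h)%nat) -> pcoef hs p <> 0.
Proof.
  revert p; induction hs as [|h hs IH]; intros p Hp Hh; simpl; [lra|].
  apply Rmult_integral_contrapositive_currified.
  - apply Rmult_integral_contrapositive_currified.
    + apply not_0_INR. specialize (Hh h (or_introl eq_refl)). lia.
    + intros ->. apply Hp. now exists 0%Z.
  - apply IH; [|intros; apply Hh; now right].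
    intros [k Hk]. apply Hp. exists (k + 1)%Z. rewrite plus_IZR, <- Hk. ring.
Qed.

Lemma Rpower_neg_lim s : 0 < s -> is_lim_seq (fun n => Rpower (INR n) (- s)) 0.
Proof.
  intros Hs. unfold Rpower.
  apply (filterlim_comp _ _ _ (fun n => - s * ln (INR n)) exp eventually (Rbar_locally m_infty)).
  - apply (is_lim_seq_ext (fun n => - s * ln (INR n))); [easy|].
    replace m_infty with (Rbar_mult (- s) p_infty).
    + apply is_lim_seq_scal_l.
      apply (filterlim_comp _ _ _ INR ln eventually (Rbar_locally p_infty)).
      * apply is_lim_seq_INR.
      * apply is_lim_ln_p.
    + simpl. destruct (Rle_dec 0 (- s)); [exfalso; lra|easy].
  - apply is_lim_exp_m.
Qed.

(** Serves to compare n^(1-s) with its value at a mean value point within L of n, or at n + 1. *)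
Lemma Rpower_concave_incr s x y L : 0 < s < 1 -> 1 <= x -> x <= y <= x + L ->
  0 <= Rpower y (1 - s) - Rpower x (1 - s) <= L * Rpower x (- s).
Proof.
  intros Hs Hx Hy. assert (HR : 0 < Rpower x (- s)) by apply exp_pos.
  destruct (Req_dec x y) as [<-|Hxy]; [nra|].
  destruct (MVT_cor2 (fun t => Rpower t (1 - s)) (fun t => (1 - s) * Rpower t (1 - s - 1)) x y)
    as [t [Ht1 Ht2]]; [lra|intros; apply derivable_pt_lim_power; lra|].
  rewrite Ht1. replace (1 - s - 1) with (- s) by ring.
  assert (H1 : Rpower t (- s) <= Rpower x (- s)).
  { rewrite !Rpower_Ropp. apply Rinv_le_contravar; [apply exp_pos|]. apply Rle_Rpower_l; lra. }
  assert (H2 : 0 < Rpower t (- s)) by apply exp_pos.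
  split; [apply Rmult_le_pos; [apply Rmult_le_pos|]; lra|].
  apply Rle_trans with (Rpower t (- s) * (y - x)).
  - apply Rmult_le_compat_r; nra.
  - rewrite (Rmult_comm L). apply Rmult_le_compat; lra.
Qed.

(** The increment of the phase is gamma xi^(s-1) with xi within a bounded distance of n, so the
    weight n^(1-s) turns it into a sequence with the nonzero limit gamma, as [slow_phase]
    demands. *)
Lemma slow_power_sum (theta c : R) (hs : list nat) :
  theta <> 0 -> ~ is_integer c -> (forall h, In h hs -> (0 < h)%nat) ->
  INR (length hs) < c < INR (length hs) + 1 ->
  sublinear (fun N => Cmod (Csum (seq 1 N) (fun n => e (theta * pdiff hs c (INR n))))).
Proof.
  intros Ht Hc Hh Hk. set (s := c - INR (length hs)).
  assert (Hs : 0 < s < 1) by (unfold s; lra).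
  assert (Hh' : forall h, In h (1 :: hs)%nat -> (0 < h)%nat).
  { intros h [<-|H]; [lia|now apply Hh]. }
  (* Passing from n to n + 1 is one more difference, with step 1; hence the list [1 :: hs]. *)
  set (gamma := theta * pcoef (1 :: hs)%nat c).
  assert (Hg : gamma <> 0).
  { apply Rmult_integral_contrapositive_currified; [easy|now apply pcoef_neq0]. }
  set (L := INR (list_sum (1 :: hs)%nat)).
  assert (Hd : forall n, (1 <= n)%nat -> exists xi, INR n <= xi <= INR n + L /\
     theta * pdiff hs c (INR (n + 1)) - theta * pdiff hs c (INR n) = gamma * Rpower xi (- (1 - s))).
  { intros n Hn. destruct (pdiff_mvt (1 :: hs)%nat c (INR n)) as [xi [H1 H2]]; [|easy|].
    { apply (lt_INR 0); lia. }
    exists xi. split; [easy|]. simpl pdiff in H2. rewrite plus_INR.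
    rewrite <- Rmult_minus_distr_l. change (INR 1) with 1. rewrite H2. unfold gamma, s.
    change (length (1 :: hs)%nat) with (Datatypes.S (length hs)). rewrite S_INR.
    rewrite Rmult_assoc. do 3 f_equal. ring. }
  assert (Hn1 : forall n, (1 <= n)%nat -> 1 <= INR n) by (intros n Hn; now apply (le_INR 1)).
  assert (Hxi1 : forall n xi, (1 <= n)%nat -> INR n <= xi ->
            0 < Rpower xi (- (1 - s)) <= Rpower (INR n) (- (1 - s))).
  { intros n xi Hn Hxi. specialize (Hn1 n Hn). split; [apply exp_pos|].
    rewrite !Rpower_Ropp. apply Rinv_le_contravar; [apply exp_pos|]. apply Rle_Rpower_l; lra. }
  apply slow_phase with (w := fun n => Rpower (INR n) (1 - s)) (gamma := gamma); [easy|..].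
  - apply is_lim_seq_spec. intros eps.
    assert (Hlim : is_lim_seq (fun n => Rabs gamma * L * Rpower (INR n) (- s)) 0).
    { replace 0 with (Rabs gamma * L * 0) by ring.
      apply (is_lim_seq_scal_l _ _ 0). apply Rpower_neg_lim; lra. }
    apply is_lim_seq_spec in Hlim. destruct (Hlim eps) as [N0 H0].
    exists (Datatypes.S N0). intros n Hn.
    specialize (H0 n ltac:(lia)). apply Rle_lt_trans with (2 := H0).
    rewrite Rminus_0_r. eapply Rle_trans; [|apply Rle_abs].
    destruct (Hd n ltac:(lia)) as [xi [Hx1 ->]].
    assert (Hn' := Hn1 n ltac:(lia)).
    destruct (Hxi1 n xi ltac:(lia) ltac:(lra)) as [H1 H2].
    assert (H3 : Rpower (INR n) (- (1 - s)) <= 1).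
    { apply Rle_trans with (Rpower (INR n) 0); [apply Rle_Rpower|rewrite Rpower_O]; lra. }
    destruct (Rpower_concave_incr s (INR n) xi L Hs Hn' Hx1) as [H4 H5].
    assert (H6 : Rpower xi (1 - s) * Rpower xi (- (1 - s)) = 1).
    { rewrite <- Rpower_plus, Rplus_opp_r. apply Rpower_O; lra. }
    replace (Rpower (INR n) (1 - s) * (gamma * Rpower xi (- (1 - s))) - gamma) with
      (- gamma * ((Rpower xi (1 - s) - Rpower (INR n) (1 - s)) * Rpower xi (- (1 - s)))).
    2:{ transitivity (Rpower (INR n) (1 - s) * (gamma * Rpower xi (- (1 - s)))
                     - gamma * (Rpower xi (1 - s) * Rpower xi (- (1 - s)))); [ring|].
        rewrite H6; ring. }
    rewrite Rabs_mult, Rabs_Ropp, Rmult_assoc.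
    apply Rmult_le_compat_l; [apply Rabs_pos|]. rewrite Rabs_pos_eq by (apply Rmult_le_pos; lra).
    rewrite <- (Rmult_1_r (L * _)). apply Rmult_le_compat; lra.
  - apply is_lim_seq_le_le_loc with (u := fun _ => 0) (w := fun n => 1 * Rpower (INR n) (- s)).
    + exists 1%nat. intros n Hn. apply Rpower_concave_incr; [easy|now apply Hn1|].
      rewrite plus_INR. simpl; lra.
    + apply is_lim_seq_const.
    + replace 0 with (1 * 0) by ring. apply (is_lim_seq_scal_l _ _ 0). apply Rpower_neg_lim; lra.
  - apply is_lim_seq_abs_0.
    apply is_lim_seq_le_le_loc with (u := fun _ => 0)
      (w := fun n => Rabs gamma * Rpower (INR n) (- (1 - s))).
    + exists 1%nat. intros n Hn. split; [apply Rabs_pos|].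
      destruct (Hd n Hn) as [xi [Hx1 ->]]. rewrite Rabs_mult.
      apply Rmult_le_compat_l; [apply Rabs_pos|].
      destruct (Hxi1 n xi Hn ltac:(lra)). rewrite Rabs_pos_eq; lra.
    + apply is_lim_seq_const.
    + replace 0 with (Rabs gamma * 0) by ring. apply (is_lim_seq_scal_l _ _ 0).
      apply Rpower_neg_lim; lra.
Qed.

Lemma power_exponential_sum (theta c : R) : theta <> 0 -> 0 < c -> ~ is_integer c ->
  sublinear (fun N => Cmod (Csum (seq 1 N) (fun n => e (theta * Rpower (INR n) c)))).
Proof.
  intros Ht Hc0 Hc. destruct (nfloor_ex c) as [k [Hk1 Hk2]]; [lra|].
  assert (Hk : INR k <> c).
  { intros Hk. apply Hc. exists (Z.of_nat k). now rewrite <- INR_IZR_INZ. }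
  (* [j] counts the differencings still to be done; [hs] stays arbitrary because van der Corput's
     lemma asks for every positive lag. *)
  assert (H : forall j hs, (j + length hs = k)%nat -> (forall h, In h hs -> (0 < h)%nat) ->
    sublinear (fun N => Cmod (Csum (seq 1 N) (fun n => e (theta * pdiff hs c (INR n)))))).
  { induction j as [|j IH]; intros hs Hj Hh.
    - apply slow_power_sum; try easy. simpl in Hj. rewrite Hj. lra.
    - apply van_der_corput; [intros; rewrite Cmod_e; lra|]. intros h Hh0.
      apply sublinear_le with (2 := IH (h :: hs) ltac:(simpl; lia)
        ltac:(intros h' [<-|H']; [easy|now apply Hh])).
      intros N. right. f_equal. apply Csum_ext. intros n _.
      rewrite Cconj_e, <- e_plus. f_equal. simpl. rewrite plus_INR. ring. }
  apply (H k nil); [simpl; lia|easy].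
Qed.

(** * Sums over multiples *)

Lemma Rsum_filter {A} (b : A -> bool) (l : list A) f :
  Rsum (filter b l) f = Rsum l (fun a => if b a then f a else 0).
Proof. induction l as [|a l IH]; simpl; [easy|]. destruct (b a); simpl; rewrite IH; lra. Qed.

Lemma Csum_filter {A} (b : A -> bool) (l : list A) f :
  Csum (filter b l) f = Csum l (fun a => if b a then f a else 0%C).
Proof. induction l as [|a l IH]; simpl; [easy|]. destruct (b a); simpl; rewrite IH; ring. Qed.

Lemma Rsum_map {A B} (h : A -> B) (l : list A) f : Rsum (map h l) f = Rsum l (fun a => f (h a)).
Proof. induction l as [|a l IH]; simpl; [easy|]. now rewrite IH. Qed.

Lemma Csum_map {A B} (h : A -> B) (l : list A) f : Csum (map h l) f = Csum l (fun a => f (h a)).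
Proof. induction l as [|a l IH]; simpl; [easy|]. now rewrite IH. Qed.

Definition divb (p n : nat) : bool := (n mod p =? 0)%nat.

Lemma divb_divide p n : p <> 0%nat -> divb p n = true <-> Nat.divide p n.
Proof. intros Hp. unfold divb. rewrite Nat.eqb_eq. now apply Nat.Lcm0.mod_divide. Qed.

Lemma filter_multiples p N : (0 < p)%nat ->
  filter (divb p) (seq 1 N) = map (Nat.mul p) (seq 1 (N / p)).
Proof.
  intros Hp. induction N as [|N IH]; [now rewrite Nat.Div0.div_0_l|].
  rewrite seq_S, filter_app, IH. simpl filter.
  assert (H1 := Nat.div_mod_eq N p). assert (H2 := Nat.mod_upper_bound N p ltac:(lia)).
  unfold divb. change (1 + N)%nat with (Datatypes.S N).
  destruct (Nat.eqb_spec (Datatypes.S N mod p) 0) as [H|H].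
  - apply Nat.Lcm0.mod_divide in H. destruct H as [k Hk].
    replace (Datatypes.S N / p)%nat with k by (rewrite Hk, Nat.div_mul; lia).
    destruct k as [|k]; [lia|].
    assert (HNk : k = (N / p)%nat) by (apply Nat.div_unique with (p - 1)%nat; nia).
    rewrite <- HNk, seq_S, map_app. simpl map. do 2 f_equal. nia.
  - rewrite app_nil_r. do 2 f_equal.
    apply Nat.div_unique with (Datatypes.S (N mod p)); [|lia].
    destruct (Nat.eq_dec (Datatypes.S (N mod p)) p) as [E|E]; [|lia].
    exfalso. apply H. apply Nat.Lcm0.mod_divide. exists (Datatypes.S (N / p)). nia.
Qed.

Lemma Rsum_multiples p N g : (0 < p)%nat ->
  Rsum (seq 1 N) (fun n => if divb p n then g n else 0) =
  Rsum (seq 1 (N / p)) (fun m => g (p * m)%nat).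
Proof. intros Hp. now rewrite <- Rsum_filter, filter_multiples, Rsum_map. Qed.

Lemma Csum_multiples p N g : (0 < p)%nat ->
  Csum (seq 1 N) (fun n => if divb p n then g n else 0%C) =
  Csum (seq 1 (N / p)) (fun m => g (p * m)%nat).
Proof. intros Hp. now rewrite <- Csum_filter, filter_multiples, Csum_map. Qed.

Lemma filter_leb_seq k N : (k <= N)%nat -> filter (fun n => n <=? k)%nat (seq 1 N) = seq 1 k.
Proof.
  intros H. replace N with (k + (N - k))%nat by lia. rewrite seq_app, filter_app.
  rewrite (forallb_filter_id _ (seq 1 k)).
  - replace (filter _ (seq (1 + k) _)) with (@nil nat); [apply app_nil_r|].
    symmetry. apply incl_l_nil. intros n Hn. apply filter_In in Hn. destruct Hn as [H1 H2].
    apply in_seq in H1. apply Nat.leb_le in H2. lia.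
  - apply forallb_forall. intros n Hn. apply in_seq in Hn. apply Nat.leb_le. lia.
Qed.

Lemma INR_div_le N p : (0 < p)%nat -> INR (N / p) <= INR N * / INR p.
Proof.
  intros Hp. assert (Hp' : 0 < INR p) by now apply (lt_INR 0).
  apply Rmult_le_reg_r with (INR p); [easy|].
  rewrite Rmult_assoc, Rinv_l, Rmult_1_r, <- mult_INR by lra.
  apply le_INR. rewrite Nat.mul_comm. apply Nat.Div0.mul_div_le.
Qed.

Lemma INR_div_ge N p : (0 < p)%nat -> INR N * / INR p - 1 <= INR (N / p).
Proof.
  intros Hp. assert (Hp' : 0 < INR p) by now apply (lt_INR 0).
  apply Rmult_le_reg_r with (INR p); [easy|].
  rewrite Rmult_minus_distr_r, Rmult_assoc, Rinv_l, Rmult_1_r, Rmult_1_l by lra.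
  assert (H : (N <= N / p * p + p)%nat).
  { rewrite (Nat.div_mod_eq N p) at 1. generalize (Nat.mod_upper_bound N p ltac:(lia)). nia. }
  apply le_INR in H. rewrite plus_INR, mult_INR in H. lra.
Qed.

(** * Divergence of the sum of reciprocals of primes *)

Definition nat_prime (p : nat) : Prop :=
  (1 < p)%nat /\ forall d, Nat.divide d p -> d = 1%nat \/ d = p.

Definition primeb (p : nat) : bool :=
  if excluded_middle_informative (nat_prime p) then true else false.

Lemma primeb_true p : primeb p = true <-> nat_prime p.
Proof. unfold primeb. destruct (excluded_middle_informative (nat_prime p)); now split. Qed.

Lemma prime_divisor_ex n : (1 < n)%nat -> exists p, nat_prime p /\ Nat.divide p n.
Proof.
  induction n as [n IH] using (well_founded_induction lt_wf). intros Hn.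
  destruct (classic (nat_prime n)) as [H|H]; [exists n; split; [easy|apply Nat.divide_refl]|].
  assert (exists d, Nat.divide d n /\ d <> 1%nat /\ d <> n) as (d & Hd & H1 & H2).
  { apply NNPP. intros HN. apply H. split; [easy|]. intros d Hd.
    apply NNPP. intros H'. apply HN. exists d. tauto. }
  assert (Hdn : (d <= n)%nat) by (apply Nat.divide_pos_le; [lia|easy]).
  assert (d <> 0%nat) by (intros ->; apply Nat.divide_0_l in Hd; lia).
  destruct (IH d) as (p & Hp & Hpd); [lia|lia|].
  exists p. split; [easy|]. now apply Nat.divide_trans with d.
Qed.

Lemma prime_gcd p m : nat_prime p -> ~ Nat.divide p m -> Nat.gcd p m = 1%nat.
Proof.
  intros [_ Hp] Hm. destruct (Hp (Nat.gcd p m)) as [H|H]; [apply Nat.gcd_divide_l|easy|].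
  exfalso. apply Hm. rewrite <- H. apply Nat.gcd_divide_r.
Qed.

Lemma prime_gcd_neq p q : nat_prime p -> nat_prime q -> p <> q -> Nat.gcd p q = 1%nat.
Proof.
  intros Hp Hq Hpq. apply prime_gcd; [easy|]. intros H.
  destruct (proj2 Hq p H) as [->|]; [|easy]. destruct Hp; lia.
Qed.

Definition smooth (k n : nat) : Prop :=
  forall p, nat_prime p -> Nat.divide p n -> (p <= k)%nat.

(** A truncated Euler product over the primes up to [k]: cutting at [N] keeps the sum finite, and
    the bounds below are uniform in [N]. *)
Definition smooth_sum (k N : nat) : R :=
  Rsum (seq 1 N) (fun n => if excluded_middle_informative (smooth k n) then / INR n else 0).

Definition prime_recip_sum (k : nat) : R := Rsum (filter primeb (seq 1 k)) (fun p => / INR p).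

Lemma inv_INR_ge0 n : 0 <= / INR n.
Proof.
  destruct n as [|n]; [simpl; rewrite Rinv_0; lra|].
  left. apply Rinv_0_lt_compat, (lt_INR 0). lia.
Qed.

Lemma smooth_sum_1 N : smooth_sum 1 N <= 1.
Proof.
  destruct N as [|N]; [unfold smooth_sum; simpl; lra|].
  rewrite <- (Rsum_single (seq 1 (Datatypes.S N)) 1 1); [|apply seq_NoDup|now left].
  apply Rsum_le. intros n Hn. apply in_seq in Hn.
  destruct (Nat.eq_dec 1 n) as [<-|H1].
  - simpl. rewrite Rinv_1. destruct excluded_middle_informative; lra.
  - destruct excluded_middle_informative as [H|_]; [|lra]. exfalso.
    destruct (prime_divisor_ex n) as (p & Hp & Hd); [lia|].
    specialize (H p Hp Hd). destruct Hp. lia.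
Qed.

(* Multiples of the new prime p contribute at most a 1/p fraction of the whole sum. *)
Lemma smooth_sum_prime k N : nat_prime (Datatypes.S k) ->
  smooth_sum (Datatypes.S k) N <=
  smooth_sum k N + / INR (Datatypes.S k) * smooth_sum (Datatypes.S k) N.
Proof.
  intros Hp. set (p := Datatypes.S k) in *.
  assert (Hp0 : (0 < p)%nat) by (unfold p; lia).
  set (h := fun n => if excluded_middle_informative (smooth p n) then / INR n else 0).
  assert (Hh : forall n, 0 <= h n).
  { intros n. unfold h. destruct excluded_middle_informative; [apply inv_INR_ge0|lra]. }
  apply Rle_trans with (smooth_sum k N + Rsum (seq 1 N) (fun n => if divb p n then h n else 0)).
  - unfold smooth_sum. rewrite <- Rsum_plus. apply Rsum_le. intros n _. fold (h n).
    destruct (divb p n) eqn:E.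
    + destruct (excluded_middle_informative (smooth k n)); [|lra].
      generalize (inv_INR_ge0 n). lra.
    + unfold h. destruct (excluded_middle_informative (smooth p n)) as [H|_].
      * destruct (excluded_middle_informative (smooth k n)) as [_|H']; [lra|].
        exfalso. apply H'. intros q Hq Hd. specialize (H q Hq Hd).
        destruct (Nat.eq_dec q p) as [->|]; [|lia].
        apply divb_divide in Hd; [congruence|lia].
      * destruct (excluded_middle_informative (smooth k n)); [|lra].
        generalize (inv_INR_ge0 n). lra.
  - apply Rplus_le_compat_l. rewrite Rsum_multiples by easy. unfold smooth_sum.
    rewrite <- Rsum_scal.
    assert (HN : (N / p <= N)%nat) by (apply Nat.Div0.div_le_upper_bound; nia).
    replace N with (N / p + (N - N / p))%nat at 2 by lia. rewrite seq_app, Rsum_app.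
    rewrite <- (Rplus_0_r (Rsum (seq 1 (N / p)) _)). apply Rplus_le_compat.
    + apply Rsum_le. intros m _. fold (h m). unfold h.
      destruct (excluded_middle_informative (smooth p (p * m))) as [H|_].
      * destruct (excluded_middle_informative (smooth p m)) as [_|H'].
        -- rewrite mult_INR, Rinv_mult. lra.
        -- exfalso. apply H'. intros q Hq Hd. apply H; [easy|]. now apply Nat.divide_mul_r.
      * apply Rmult_le_pos; [apply inv_INR_ge0|apply Hh].
    + apply Rsum_ge0. intros m _. apply Rmult_le_pos; [apply inv_INR_ge0|apply Hh].
Qed.

(** A new prime p multiplies the sum by at most 1/(1 - 1/p). With x = 1/p <= 1/2 one has (1 - x)(1 +
    2x) >= 1, so this factor is at most 1 + 2x <= exp(2x). *)
Lemma smooth_sum_le k N : (1 <= k)%nat -> smooth_sum k N <= exp (2 * prime_recip_sum k).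
Proof.
  induction k as [|k IH]; [lia|]. intros _.
  destruct (Nat.eq_dec k 0) as [->|Hk].
  { apply Rle_trans with (1 := smooth_sum_1 N). rewrite <- exp_0.
    unfold prime_recip_sum. simpl. destruct (primeb 1) eqn:E.
    - apply primeb_true in E. destruct E; lia.
    - simpl. right. f_equal. ring. }
  specialize (IH ltac:(lia)). unfold prime_recip_sum in *.
  rewrite seq_S, filter_app, Rsum_app. simpl filter. change (1 + k)%nat with (Datatypes.S k).
  destruct (primeb (Datatypes.S k)) eqn:E.
  - apply primeb_true in E. assert (H := smooth_sum_prime k N E).
    set (x := / INR (Datatypes.S k)) in *. unfold Rsum at 2. cbn [fold_right]. fold x.
    rewrite Rplus_0_r, Rmult_plus_distr_l, exp_plus.
    assert (Hx : 0 <= x <= / 2).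
    { split; [apply inv_INR_ge0|]. apply Rinv_le_contravar; [lra|].
      rewrite S_INR. assert (1 <= INR k) by (apply (le_INR 1); lia). lra. }
    assert (H2 : 1 + 2 * x <= exp (2 * x)) by apply exp_ineq1_le.
    assert (H3 : 0 <= smooth_sum (Datatypes.S k) N).
    { apply Rsum_ge0. intros n _. destruct excluded_middle_informative; [apply inv_INR_ge0|lra]. }
    apply Rle_trans with (smooth_sum k N * exp (2 * x)).
    + apply Rle_trans with ((1 - x) * smooth_sum (Datatypes.S k) N * exp (2 * x)).
      * apply Rle_trans with ((1 - x) * smooth_sum (Datatypes.S k) N * (1 + 2 * x)).
        2:{ apply Rmult_le_compat_l; [apply Rmult_le_pos; lra|easy]. }
        assert (0 <= smooth_sum (Datatypes.S k) N * (x * (1 - 2 * x))) by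
          (apply Rmult_le_pos; [easy|nra]). nra.
      * apply Rmult_le_compat_r; [left; apply exp_pos|lra].
    + apply Rmult_le_compat_r; [left; apply exp_pos|easy].
  - simpl. rewrite Rplus_0_r. apply Rle_trans with (2 := IH). apply Rsum_le. intros n _.
    destruct (excluded_middle_informative (smooth (Datatypes.S k) n)) as [H|_].
    + destruct (excluded_middle_informative (smooth k n)) as [_|H']; [lra|].
      exfalso. apply H'. intros q Hq Hd. specialize (H q Hq Hd).
      destruct (Nat.eq_dec q (Datatypes.S k)) as [->|]; [|lia].
      apply primeb_true in Hq. congruence.
    + destruct (excluded_middle_informative (smooth k n)); [apply inv_INR_ge0|lra].
Qed.

(** The product of the factors 1 + 1/n <= exp(1/n) telescopes. *)
Lemma harmonic_ge N : INR N + 1 <= exp (Rsum (seq 1 N) (fun n => / INR n)).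
Proof.
  induction N as [|N IH]; [simpl; rewrite exp_0; lra|].
  rewrite Rsum_seq_S, exp_plus, S_INR. change (1 + N)%nat with (Datatypes.S N). rewrite S_INR.
  assert (H := exp_ineq1_le (/ (INR N + 1))). assert (H0 := pos_INR N).
  apply Rle_trans with ((INR N + 1) * (1 + / (INR N + 1))); [right; field; lra|].
  apply Rmult_le_compat; try easy; [lra|].
  assert (0 < / (INR N + 1)) by (apply Rinv_0_lt_compat; lra). lra.
Qed.

(** Euler's argument: every n <= N is N-smooth, so N + 1 is at most exp(exp(2 sum 1/p)); this
    explains the double exponential in the choice of N. *)
Lemma prime_recip_diverges A : exists N, A <= prime_recip_sum N.
Proof.
  destruct (nfloor_ex (exp (exp (2 * A)))) as [N [_ HN]]; [left; apply exp_pos|].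
  exists (Datatypes.S N). apply Rnot_lt_le. intros H.
  assert (H1 := harmonic_ge (Datatypes.S N)). rewrite S_INR in H1.
  assert (H2 : Rsum (seq 1 (Datatypes.S N)) (fun n => / INR n) <=
               smooth_sum (Datatypes.S N) (Datatypes.S N)).
  { apply Rsum_le. intros n Hn. apply in_seq in Hn.
    destruct excluded_middle_informative as [_|H']; [lra|].
    exfalso. apply H'. intros p _ Hd. apply Nat.divide_pos_le in Hd; lia. }
  assert (H3 := smooth_sum_le (Datatypes.S N) (Datatypes.S N) ltac:(lia)).
  assert (H4 : exp (2 * prime_recip_sum (Datatypes.S N)) < exp (2 * A))
    by (apply exp_increasing; lra).
  assert (H5 : exp (Rsum (seq 1 (Datatypes.S N)) (fun n => / INR n)) < exp (exp (2 * A)))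
    by (apply exp_increasing; lra).
  lra.
Qed.

(** The primes up to K contribute at most K to the sum, so it is enough to reach A + K before
    discarding them. *)
Lemma large_primes_ex K A : exists P, NoDup P /\
  (forall p, In p P -> nat_prime p /\ (K <= p)%nat) /\ A <= Rsum P (fun p => / INR p).
Proof.
  destruct (prime_recip_diverges (A + INR K)) as [N HN].
  exists (filter primeb (seq (1 + K) N)). split; [apply NoDup_filter, seq_NoDup|]. split.
  - intros p Hp. apply filter_In in Hp. destruct Hp as [H1 H2].
    apply in_seq in H1. split; [now apply primeb_true|lia].
  - assert (H1 : prime_recip_sum N <= prime_recip_sum (K + N)).
    { unfold prime_recip_sum. rewrite (Nat.add_comm K), seq_app, filter_app, Rsum_app.
      assert (0 <= Rsum (filter primeb (seq (1 + N) K)) (fun p => / INR p))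
        by (apply Rsum_ge0; intros; apply inv_INR_ge0). lra. }
    unfold prime_recip_sum in *. rewrite seq_app, filter_app, Rsum_app in H1.
    assert (H2 : Rsum (filter primeb (seq 1 K)) (fun p => / INR p) <= INR K).
    { rewrite Rsum_filter. apply Rle_trans with (Rsum (seq 1 K) (fun _ => 1)).
      - apply Rsum_le. intros n Hn. apply in_seq in Hn. destruct (primeb n); [|lra].
        rewrite <- Rinv_1. apply Rinv_le_contravar; [lra|]. apply (le_INR 1); lia.
      - rewrite Rsum_const, length_seq. lra. }
    lra.
Qed.

(** * The orthogonality criterion of Daboussi and Katai *)

Definition omega (P : list nat) (n : nat) : R := Rsum P (fun p => if divb p n then 1 else 0).

Lemma count_multiples p N : (0 < p)%nat ->
  Rsum (seq 1 N) (fun n => if divb p n then 1 else 0) = INR (N / p).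
Proof.
  intros Hp. rewrite (Rsum_multiples p N (fun _ => 1)) by easy.
  rewrite Rsum_const, length_seq. ring.
Qed.

(** Expand the variance. For p <> q both primes divide n exactly when pq does, so the second moment
    is at most A^2 N + A N with no rounding loss. Rounding costs at most |P| in the lower bound for
    the first moment, whose weight is 2A. *)
Lemma turan_kubilius (P : list nat) N : NoDup P -> (forall p, In p P -> nat_prime p) ->
  let A := Rsum P (fun p => / INR p) in
  Rsum (seq 1 N) (fun n => (omega P n - A) ^ 2) <= A * INR N + 2 * A * INR (length P).
Proof.
  intros HP Hprime A.
  assert (HA : 0 <= A) by (apply Rsum_ge0; intros; apply inv_INR_ge0).
  assert (Hpos : forall p, In p P -> (0 < p)%nat) by (intros p Hp; destruct (Hprime p Hp); lia).
  assert (H1 : Rsum (seq 1 N) (omega P) >= A * INR N - INR (length P)).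
  { unfold omega. rewrite Rsum_switch. apply Rle_ge.
    apply Rle_trans with (Rsum P (fun p => INR N * / INR p + -1)).
    - rewrite Rsum_plus, Rsum_scal, Rsum_const. fold A. lra.
    - apply Rsum_le. intros p Hp. rewrite count_multiples by auto.
      generalize (INR_div_ge N p (Hpos p Hp)). lra. }
  assert (H2 : Rsum (seq 1 N) (fun n => omega P n * omega P n) <= INR N * A * A + A * INR N).
  { apply Rle_trans with (Rsum P (fun p => Rsum P (fun q =>
      INR N * / INR p * / INR q + if Nat.eq_dec p q then INR N * / INR p else 0))).
    - rewrite (Rsum_ext (seq 1 N) _ (fun n => Rsum P (fun p => Rsum P (fun q =>
        (if divb p n then 1 else 0) * (if divb q n then 1 else 0))))).
      2:{ intros n _. unfold omega at 1. rewrite Rmult_comm, <- Rsum_scal.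
          apply Rsum_ext. intros p _. rewrite Rmult_comm. unfold omega. now rewrite <- Rsum_scal. }
      rewrite Rsum_switch. apply Rsum_le. intros p Hp.
      rewrite Rsum_switch. apply Rsum_le. intros q Hq.
      assert (Hp0 := Hpos p Hp). assert (Hq0 := Hpos q Hq).
      assert (Hge : 0 <= INR N * / INR p) by (apply Rmult_le_pos; [apply pos_INR|apply inv_INR_ge0]).
      destruct (Nat.eq_dec p q) as [<-|Hpq].
      + apply Rle_trans with (Rsum (seq 1 N) (fun n => if divb p n then 1 else 0)).
        * apply Rsum_le. intros n _. destruct (divb p n); lra.
        * rewrite count_multiples by easy.
          generalize (INR_div_le N p Hp0) (Rmult_le_pos _ _ Hge (inv_INR_ge0 p)). lra.
      + apply Rle_trans with (Rsum (seq 1 N) (fun n => if divb (p * q) n then 1 else 0)).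
        * apply Rsum_le. intros n _.
          destruct (divb p n) eqn:E1; [|destruct (divb (p * q) n); lra].
          destruct (divb q n) eqn:E2; [|destruct (divb (p * q) n); lra].
          apply divb_divide in E1, E2; try lia.
          replace (divb (p * q) n) with true; [lra|]. symmetry. apply divb_divide; [lia|].
          destruct E1 as [a ->]. rewrite Nat.mul_comm in E2. apply Nat.gauss in E2.
          -- destruct E2 as [b ->]. exists b. lia.
          -- apply prime_gcd_neq; auto.
        * rewrite count_multiples by lia. rewrite Rplus_0_r, Rmult_assoc, <- Rinv_mult, <- mult_INR.
          apply INR_div_le. lia.
    - right. rewrite (Rsum_ext P _ (fun p => INR N * A * / INR p + INR N * / INR p)).
      + rewrite Rsum_plus, !Rsum_scal. fold A. ring.
      + intros p Hp. rewrite Rsum_plus, Rsum_scal. fold A. rewrite Rsum_single by easy. ring. }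
  rewrite (Rsum_ext _ _ (fun n => omega P n * omega P n + (- 2 * A * omega P n + A * A)))
    by (intros; ring).
  rewrite !Rsum_plus, Rsum_scal, Rsum_const, length_seq. nra.
Qed.

(** Most n have about A prime divisors in P, so A times the sum is close to [Y], the sum over p of
    the terms n = p m. Replacing f(p m) by f(p) f(m) gives [Y'], where f(m) factors out and is
    bounded by 1. What remains, [Z m], is a sum of dilates f(p) F(p m), whose mean square is at most
    A + o(1) by almost orthogonality. *)
Lemma katai (f F : nat -> C) : multiplicative f ->
  (forall n, Cmod (f n) <= 1) -> (forall n, Cmod (F n) <= 1) ->
  (forall p q, nat_prime p -> nat_prime q -> (p < q)%nat -> sublinear (fun N =>
     Cmod (Csum (seq 1 N) (fun m => F (q * m)%nat * Cconj (F (p * m)%nat))%C))) ->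
  sublinear (fun N => Cmod (Csum (seq 1 N) (fun n => f n * F n)%C)).
Proof.
  intros [_ Hmul] Hf HF Hcor eps He.
  (* The errors below total 4 t N with t = A/K, plus sublinear terms; 1/K <= eps/8 makes this at
     most (eps/2) A N. *)
  assert (He8 : 0 < eps / 8) by lra.
  destruct (nat_scale_ex _ He8) as [K [HK HKe]].
  assert (HK0 : 0 < INR K) by now apply (lt_INR 0).
  (* Primes at least K make the case p | m rare; A >= K^2 gives K <= A/K. *)
  destruct (large_primes_ex K (INR K * INR K)) as (P & HP & HPp & HPA).
  set (A := Rsum P (fun p => / INR p)) in *.
  assert (HA : 0 < A) by nra.
  assert (HPpos : forall p, In p P -> (0 < p)%nat) by (intros p Hp; specialize (HPp p Hp); lia).
  assert (Hmul1 : forall a b : C, Cmod a <= 1 -> Cmod b <= 1 -> Cmod (a * b) <= 1).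
  { intros a b Ha Hb. rewrite Cmod_mult, <- (Rmult_1_r 1).
    apply Rmult_le_compat; auto using Cmod_ge_0. }
  (* The cut-off encodes p n <= N, so that all dilates are summed over the common range 1..N. *)
  set (z := fun N p n => if (n <=? N / p)%nat then (f p * F (p * n)%nat)%C else 0%C).
  assert (HO : sublinear (fun N => Rsum (seq 1 N) (fun n => Cmod (Csum P (fun p => z N p n)) ^ 2)
                      - A * INR N)).
  { apply almost_orthogonal; [easy|..].
    - intros p Hp N. assert (Hp0 := HPpos p Hp).
      assert (HN : (N / p <= N)%nat) by (apply Nat.Div0.div_le_upper_bound; nia).
      apply Rle_trans with (Rsum (seq 1 N) (fun n => if (n <=? N / p)%nat then 1 else 0)).
      + apply Rsum_le. intros n _. unfold z. destruct (n <=? N / p)%nat.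
        * generalize (Hmul1 _ _ (Hf p) (HF (p * n)%nat)) (Cmod_ge_0 (f p * F (p * n)%nat)).
          intros. rewrite <- (pow1 2). apply pow_incr. lra.
        * rewrite Cmod_0. simpl. lra.
      + rewrite <- (Rsum_filter (fun n => n <=? N / p)%nat (seq 1 N) (fun _ => 1)).
        rewrite filter_leb_seq by easy. rewrite Rsum_const, length_seq.
        generalize (INR_div_le N p Hp0). lra.
    - intros q p Hq Hp Hpq. assert (Hp0 := HPpos p Hp). assert (Hq0 := HPpos q Hq).
      apply sublinear_le with (2 := sublinear_div q _ (Hcor p q (proj1 (HPp p Hp)) (proj1 (HPp q Hq)) Hpq) Hq0).
      intros N.
      assert (HN : (N / q <= N)%nat) by (apply Nat.Div0.div_le_upper_bound; nia).
      (* As p < q, the product of the two dilates lives on the shorter range n <= N/q. *)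
      assert (HN' : (N / q <= N / p)%nat) by (apply Nat.div_le_compat_l; lia).
      rewrite (Csum_ext _ _ (fun n => if (n <=? N / q)%nat then
        (f q * Cconj (f p) * (F (q * n)%nat * Cconj (F (p * n)%nat)))%C else 0%C)).
      + rewrite <- (Csum_filter (fun n => n <=? N / q)%nat), filter_leb_seq by easy.
        rewrite Csum_scal, Cmod_mult. rewrite <- (Rmult_1_l (Cmod (Csum _ (fun m => _)))) at 2.
        apply Rmult_le_compat_r; [apply Cmod_ge_0|].
        apply Hmul1; [apply Hf|rewrite Cmod_conj; apply Hf].
      + intros n _. unfold z. destruct (Nat.leb_spec n (N / q)) as [H|H]; [|ring].
        destruct (Nat.leb_spec n (N / p)); [|lia]. rewrite Cmult_conj. ring. }
  assert (HKA : 0 <= INR K / A / 2) by (apply Rlt_le, Rdiv_lt_0_compat; [apply Rdiv_lt_0_compat|]; lra).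
  destruct (sublinear_plus _ _ (sublinear_scal _ _ HKA HO) (sublinear_const (INR K * INR (length P)))
    (eps / 2 * A)) as [N0 H0]; [apply Rmult_lt_0_compat; lra|].
  exists N0. intros N HN. specialize (H0 N HN). cbv beta in H0.
  set (Z := fun n => Csum P (fun p => z N p n)) in *.
  set (Q := Rsum (seq 1 N) (fun n => Cmod (Z n) ^ 2)).
  change (INR K / A / 2 * (Q - A * INR N) + INR K * INR (length P) <= eps / 2 * A * INR N) in H0.
  set (X := Csum (seq 1 N) (fun n => f n * F n)%C).
  set (Y := Csum P (fun p => Csum (seq 1 (N / p)) (fun m => f (p * m)%nat * F (p * m)%nat)%C)).
  set (Y' := Csum (seq 1 N) (fun m => f m * Z m)%C).
  assert (HN0 := pos_INR N).
  (* The AM-GM parameter, used both for the variance of [omega] and for the mean square of [Z]. *)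
  set (t := A / INR K).
  assert (Ht : 0 < t) by (apply Rdiv_lt_0_compat; lra).
  assert (Ht' : / t = INR K / A) by (unfold t; field; lra).
  assert (HtK : INR K <= t).
  { unfold t. apply Rmult_le_reg_r with (INR K); [easy|].
    replace (A / INR K * INR K) with A by (field; lra). easy. }
  assert (HXY : Cmod (RtoC A * X - Y) <= t * INR N + INR K * INR (length P)).
  { assert (HY : Y = Csum (seq 1 N) (fun n => f n * F n * RtoC (omega P n))%C).
    { unfold Y.
      rewrite (Csum_ext P _ (fun p => Csum (seq 1 N) (fun n => if divb p n then (f n * F n)%C else 0%C))).
      - rewrite Csum_switch. apply Csum_ext. intros n _. unfold omega.
        rewrite <- Csum_RtoC, <- Csum_scal. apply Csum_ext. intros p _.
        destruct (divb p n); ring.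
      - intros p Hp. symmetry. apply (Csum_multiples p N (fun n => f n * F n)%C). auto. }
    rewrite HY. unfold X. rewrite <- Csum_scal, <- Csum_minus.
    eapply Rle_trans; [apply Cmod_Csum|].
    apply Rle_trans with (Rsum (seq 1 N) (fun n => Rabs (omega P n - A))).
    - apply Rsum_le. intros n _.
      replace (RtoC A * (f n * F n) - f n * F n * RtoC (omega P n))%C with
        (f n * F n * RtoC (A - omega P n))%C by (rewrite RtoC_minus; ring).
      rewrite Cmod_mult, Cmod_R, Rabs_minus_sym. rewrite <- (Rmult_1_l (Rabs _)) at 2.
      apply Rmult_le_compat_r; [apply Rabs_pos|]. now apply Hmul1.
    - eapply Rle_trans; [apply (Rsum_le_squares _ _ t Ht)|]. rewrite length_seq.
      rewrite (Rsum_ext _ (fun a => Rabs _ ^ 2) (fun n => (omega P n - A) ^ 2))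
        by (intros; apply pow2_abs).
      assert (HTK := turan_kubilius P N HP (fun p Hp => proj1 (HPp p Hp))). fold A in HTK.
      cbv zeta in HTK.
      apply Rmult_le_compat_l with (r := / t) in HTK; [|left; now apply Rinv_0_lt_compat].
      rewrite Ht' in HTK at 2.
      replace (INR K / A * (A * INR N + 2 * A * INR (length P))) with
        (INR K * INR N + 2 * (INR K * INR (length P))) in HTK by (field; lra).
      assert (INR K * INR N <= t * INR N) by now apply Rmult_le_compat_r.
      lra. }
  assert (HYY : Cmod (Y - Y') <= 2 * t * INR N).
  { assert (HY' : Y' = Csum P (fun p => Csum (seq 1 (N / p)) (fun m => f p * f m * F (p * m)%nat)%C)).
    { unfold Y', Z. rewrite (Csum_ext _ _ (fun m => Csum P (fun p => f m * z N p m)%C))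
        by (intros; now rewrite Csum_scal).
      rewrite Csum_switch. apply Csum_ext. intros p Hp. assert (Hp0 := HPpos p Hp).
      rewrite <- (filter_leb_seq (N / p) N) by (apply Nat.Div0.div_le_upper_bound; nia).
      rewrite Csum_filter. apply Csum_ext. intros m _. unfold z.
      destruct (m <=? N / p)%nat; ring. }
    rewrite HY'. unfold Y. rewrite <- Csum_minus. eapply Rle_trans; [apply Cmod_Csum|].
    (* Multiplicativity fails only for p | m; there are at most N/p^2 <= N/(K p) such m, each
       costing at most 2. *)
    apply Rle_trans with (Rsum P (fun p => 2 * / INR K * INR N * / INR p)).
    - apply Rsum_le. intros p Hp. assert (Hp0 := HPpos p Hp).
      destruct (HPp p Hp) as [Hpr HpK].
      rewrite <- Csum_minus. eapply Rle_trans; [apply Cmod_Csum|].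
      apply Rle_trans with (Rsum (seq 1 (N / p)) (fun m => 2 * if divb p m then 1 else 0)).
      + apply Rsum_le. intros m Hm. apply in_seq in Hm. destruct (divb p m) eqn:E.
        * eapply Rle_trans; [apply Cmod_minus_le|].
          generalize (Hmul1 _ _ (Hf (p * m)%nat) (HF (p * m)%nat))
            (Hmul1 _ _ (Hmul1 _ _ (Hf p) (Hf m)) (HF (p * m)%nat)). lra.
        * rewrite Hmul; [|lia|lia|].
          -- replace (_ - _)%C with (RtoC 0) by ring. rewrite Cmod_0. lra.
          -- apply prime_gcd; [easy|]. intros Hd. apply divb_divide in Hd; [congruence|lia].
      + rewrite Rsum_scal, count_multiples by easy. rewrite !Rmult_assoc.
        apply Rmult_le_compat_l; [lra|].
        eapply Rle_trans; [apply (INR_div_le _ p Hp0)|]. rewrite Rmult_comm.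
        apply Rmult_le_compat; [apply inv_INR_ge0|apply pos_INR| |now apply INR_div_le].
        apply Rinv_le_contravar; [easy|]. now apply le_INR.
    - rewrite Rsum_scal. fold A. right. unfold t. field. lra. }
  assert (HY'1 : Cmod Y' <= (t * INR N + INR K / A * Q) / 2).
  { eapply Rle_trans; [apply Cmod_Csum|].
    apply Rle_trans with (Rsum (seq 1 N) (fun n => Cmod (Z n))).
    - apply Rsum_le. intros n _. rewrite Cmod_mult. rewrite <- (Rmult_1_l (Cmod (Z n))) at 2.
      apply Rmult_le_compat_r; [apply Cmod_ge_0|apply Hf].
    - eapply Rle_trans; [apply (Rsum_le_squares _ _ t Ht)|]. rewrite length_seq, Ht'.
      unfold Q. lra. }
  assert (HX : A * Cmod X <= Cmod (RtoC A * X - Y) + Cmod (Y - Y') + Cmod Y').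
  { replace (A * Cmod X) with (Cmod (RtoC A * X)) by (rewrite Cmod_mult, Cmod_R, Rabs_pos_eq; lra).
    replace (RtoC A * X)%C with ((RtoC A * X - Y) + (Y - Y') + Y')%C at 1 by ring.
    eapply Rle_trans; [apply Cmod_triangle|]. apply Rplus_le_compat_r, Cmod_triangle. }
  apply Rmult_le_reg_l with A; [easy|].
  assert (H1 : INR K / A / 2 * (Q - A * INR N) = INR K / A * Q / 2 - INR K * INR N / 2) by (field; lra).
  assert (H2 : INR K * INR N <= t * INR N) by now apply Rmult_le_compat_r.
  assert (H3 : t * INR N <= eps / 8 * A * INR N).
  { apply Rmult_le_compat_r; [easy|]. unfold t, Rdiv at 1. rewrite Rmult_comm.
    apply Rmult_le_compat_r; lra. }
  clearbody Q X Y Y'. lra.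
Qed.

Lemma Rpower_INR_lt c p q : 0 < c -> (0 < p < q)%nat -> Rpower (INR p) c < Rpower (INR q) c.
Proof.
  intros Hc Hpq. apply Rlt_Rpower_l; [easy|]. split; [apply (lt_INR 0)|apply lt_INR]; lia.
Qed.

(** Homogeneity, (p m)^c = p^c m^c, makes the correlation of two dilates a pure power phase again;
    its frequency is nonzero because x^c is strictly increasing. *)
Lemma katai_power (f : nat -> C) (theta c : R) : multiplicative f ->
  (forall n, Cmod (f n) <= 1) -> theta <> 0 -> 0 < c -> ~ is_integer c ->
  sublinear (fun N => Cmod (Csum (seq 1 N) (fun n => f n * e (theta * Rpower (INR n) c))%C)).
Proof.
  intros Hm Hf Ht Hc0 Hc. apply katai; [easy|easy|intros; rewrite Cmod_e; lra|].
  intros p q [Hp _] [Hq _] Hpq.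
  assert (H := Rpower_INR_lt c p q Hc0 ltac:(lia)).
  apply sublinear_le with (2 := power_exponential_sum
    (theta * (Rpower (INR q) c - Rpower (INR p) c)) c
    ltac:(apply Rmult_integral_contrapositive_currified; [easy|lra]) Hc0 Hc).
  intros N. right. f_equal. apply Csum_ext. intros m Hm'. apply in_seq in Hm'.
  rewrite Cconj_e, <- e_plus. f_equal. rewrite !mult_INR, <- !Rpower_mult_distr by (apply (lt_INR 0); lia).
  ring.
Qed.

(** * Fejer approximation *)

Lemma Csum_single (l : list nat) p v :
  NoDup l -> In p l -> Csum l (fun q => if Nat.eq_dec p q then v else 0%C) = v.
Proof.
  induction 1 as [|a l Ha Hl IH]; simpl; [easy|]. intros [->|Hp].
  - destruct (Nat.eq_dec p p); [|easy].
    rewrite (Csum_ext l _ (fun _ => 0%C)), Csum_0; [ring|].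
    intros q Hq. destruct (Nat.eq_dec p q); [now subst|easy].
  - destruct (Nat.eq_dec p a); [now subst|]. rewrite IH by easy; ring.
Qed.

Definition dirichlet (J : nat) (y : R) : C := Csum (seq 0 J) (fun j => e (INR j * y)).

Lemma dirichlet_telescope J y : ((e y - 1) * dirichlet J y = e (INR J * y) - 1)%C.
Proof.
  unfold dirichlet. induction J as [|J IH]; [simpl; rewrite Rmult_0_l, e_0; ring|].
  rewrite Csum_seq_S, Cmult_plus_distr_l, IH, S_INR, Rmult_plus_distr_r, Rmult_1_l, e_plus.
  simpl. ring.
Qed.

(** From sin x >= x - x^3/6 and x <= pi/2 <= 2. Together with pi > 3 it yields sin(pi v) >= v for 0
    <= v <= 1/2. *)
Lemma sin_ge_third x : 0 <= x <= PI / 2 -> x / 3 <= sin x.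
Proof.
  intros Hx. generalize PI_4 PI2_3_2; intros.
  destruct (sin_bound x 0) as [H1 _]; [lra|lra|].
  unfold sin_approx, sin_term in H1. simpl in H1.
  assert (0 <= x * (4 - x * x)) by (apply Rmult_le_pos; nra).
  replace (- (1) * 1) with (-1) in H1 by ring. lra.
Qed.

Lemma nearest_integer y : exists k : Z, Rabs (y - IZR k) <= / 2.
Proof.
  exists (Int_part (y + / 2)). destruct (base_Int_part (y + / 2)). apply Rabs_le. lra.
Qed.

Lemma Cmod_e_minus_1_ge u : Rabs u <= / 2 -> 2 * Rabs u <= Cmod (e u - 1).
Proof.
  intros Hu. rewrite Cmod_e_minus_1. apply Rmult_le_compat_l; [lra|].
  generalize PI_4 PI2_3_2; intros.
  assert (H1 : forall v, 0 <= v <= / 2 -> v <= sin (PI * v)).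
  { intros v Hv. generalize (sin_ge_third (PI * v) ltac:(split; nra)). nra. }
  destruct (Rle_lt_dec 0 u) as [H2|H2].
  - rewrite (Rabs_pos_eq u) in * by lra. eapply Rle_trans; [|apply Rle_abs]. now apply H1.
  - rewrite (Rabs_left u) in * by lra. rewrite <- Rabs_Ropp, <- sin_neg.
    eapply Rle_trans; [|apply Rle_abs]. rewrite <- Ropp_mult_distr_r_reverse.
    apply H1; lra.
Qed.

Lemma e_plus_Z u k : e (u + IZR k) = e u.
Proof. rewrite e_plus, e_Z. ring. Qed.

Lemma Cmod_e_minus_1_far d y : (forall k, d <= Rabs (y - IZR k)) -> 2 * d <= Cmod (e y - 1).
Proof.
  intros H. destruct (nearest_integer y) as [k Hk].
  replace y with (y - IZR k + IZR k) by ring. rewrite e_plus_Z.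
  generalize (Cmod_e_minus_1_ge _ Hk) (H k). lra.
Qed.

(** Normalised by J^2 instead of the customary J, so that the J translates by l/J form a partition
    of unity. *)
Definition fejer (J : nat) (y : R) : R := Cmod (dirichlet J y) ^ 2 / INR J ^ 2.

Lemma fejer_ge0 J y : 0 <= fejer J y.
Proof.
  apply Rmult_le_pos; [apply pow2_ge_0|].
  destruct J as [|J]; [simpl; rewrite Rmult_0_l, Rinv_0; lra|].
  left. apply Rinv_0_lt_compat, pow_lt, (lt_INR 0). lia.
Qed.

Lemma fejer_expand J y : RtoC (fejer J y) =
  Csum (seq 0 J) (fun i => Csum (seq 0 J) (fun j =>
    RtoC (/ INR J ^ 2) * e ((INR i - INR j) * y))%C).
Proof.
  unfold fejer, Rdiv. rewrite RtoC_mult, Cmod_sqr, Cmult_comm. unfold dirichlet.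
  rewrite Cconj_Csum, (Cmult_comm (Csum _ _)), <- !Csum_scal. apply Csum_ext. intros i _.
  rewrite (Cmult_comm (Csum _ _)), <- !Csum_scal. apply Csum_ext. intros j _.
  rewrite Cconj_e, <- e_plus. do 2 f_equal. ring.
Qed.

(** With u = (j - i)/J, e(J u) = 1 while e(u) <> 1, so the telescoping identity forces the sum to
    vanish. *)
Lemma roots_of_unity_sum J i j : (i < J)%nat -> (j < J)%nat -> i <> j ->
  dirichlet J ((INR j - INR i) / INR J) = 0%C.
Proof.
  intros Hi Hj Hij. set (u := (INR j - INR i) / INR J).
  assert (HJ : 0 < INR J) by (apply (lt_INR 0); lia).
  assert (H1 := dirichlet_telescope J u).
  replace (INR J * u) with (IZR (Z.of_nat j - Z.of_nat i)) in H1
    by (rewrite minus_IZR, <- !INR_IZR_INZ; unfold u; field; lra).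
  rewrite e_Z in H1.
  assert (H2 : (e u - 1)%C <> 0%C).
  { apply Cmod_gt_0.
    assert (Hu : u * INR J = INR j - INR i) by (unfold u; field; lra).
    apply Rlt_le_trans with (2 * / INR J); [assert (0 < / INR J) by (now apply Rinv_0_lt_compat); lra|].
    apply Cmod_e_minus_1_far. intros k.
    apply Rmult_le_reg_r with (INR J); [easy|]. rewrite Rinv_l by lra.
    rewrite <- (Rabs_pos_eq (INR J)) at 1 by lra. rewrite <- Rabs_mult, Rmult_minus_distr_r, Hu.
    rewrite !INR_IZR_INZ, <- mult_IZR, <- !minus_IZR, <- abs_IZR. apply IZR_le.
    assert (Z.of_nat j - Z.of_nat i - k * Z.of_nat J <> 0)%Z; [|lia].
    assert (k = 0 \/ 1 <= k \/ k <= -1)%Z as [->|[Hk|Hk]] by lia; nia. }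
  destruct (Ceq_dec (dirichlet J u) 0) as [|H3]; [easy|].
  exfalso. apply (Cmult_neq_0 _ _ H2 H3). rewrite H1. ring.
Qed.

(** Summing over l kills every harmonic with i <> j; each of the J diagonal terms contributes
    1/J. *)
Lemma fejer_partition J y : (0 < J)%nat ->
  Rsum (seq 0 J) (fun l => fejer J (y - INR l / INR J)) = 1.
Proof.
  intros HJ. assert (HJ0 : 0 < INR J) by now apply (lt_INR 0).
  apply RtoC_inj. rewrite <- Csum_RtoC.
  rewrite (Csum_ext _ _ (fun l => Csum (seq 0 J) (fun i => Csum (seq 0 J) (fun j =>
    RtoC (/ INR J ^ 2) * e ((INR i - INR j) * (y - INR l / INR J)))%C)))
    by (intros; apply fejer_expand).
  rewrite Csum_switch.
  rewrite (Csum_ext _ _ (fun _ => RtoC (/ INR J))).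
  - rewrite Csum_RtoC, Rsum_const, length_seq, Rinv_r; [easy|lra].
  - intros i Hi. rewrite Csum_switch.
    rewrite <- (Csum_single (seq 0 J) i (RtoC (/ INR J)) (seq_NoDup _ _) Hi).
    apply Csum_ext. intros j Hj. rewrite Csum_scal. apply in_seq in Hi, Hj.
    rewrite (Csum_ext _ _ (fun l => e ((INR i - INR j) * y) * e (INR l * ((INR j - INR i) / INR J)))%C).
    2:{ intros l _. rewrite <- e_plus. f_equal. field. lra. }
    rewrite Csum_scal. fold (dirichlet J ((INR j - INR i) / INR J)).
    destruct (Nat.eq_dec i j) as [<-|Hij].
    + rewrite !Rminus_diag. unfold dirichlet, Rdiv. rewrite !Rmult_0_l, e_0.
      rewrite (Csum_ext _ _ (fun _ => RtoC 1)) by (intros; now rewrite Rmult_0_r, e_0).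
      rewrite Csum_RtoC, Rsum_const, length_seq, Cmult_1_l, <- RtoC_mult. f_equal. field. lra.
    + rewrite roots_of_unity_sum by lia. ring.
Qed.

Lemma fejer_far J d y : (0 < J)%nat -> 0 < d -> (forall k, d <= Rabs (y - IZR k)) ->
  fejer J y <= / (INR J ^ 2 * d ^ 2).
Proof.
  intros HJ Hd H. assert (HJ0 : 0 < INR J) by now apply (lt_INR 0).
  assert (H1 := Cmod_e_minus_1_far d y H).
  assert (H2 : Cmod (e y - 1) * Cmod (dirichlet J y) <= 2).
  { rewrite <- Cmod_mult, dirichlet_telescope. eapply Rle_trans; [apply Cmod_minus_le|].
    rewrite Cmod_e, Cmod_1. lra. }
  assert (H3 := Cmod_ge_0 (dirichlet J y)).
  assert (H4 : Cmod (dirichlet J y) <= / d).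
  { apply Rmult_le_reg_l with d; [easy|]. rewrite Rinv_r by lra. nra. }
  unfold fejer, Rdiv. rewrite Rinv_mult, Rmult_comm, <- (pow_inv d).
  apply Rmult_le_compat_l; [left; now apply Rinv_0_lt_compat, pow_lt|].
  apply pow_incr. lra.
Qed.

(* The name [floor] is shadowed by Coquelicot's; [Int_part] is the floor of [Defs.S]. *)
Definition frac_phase (alpha y : R) : C := e (- alpha * (y - IZR (Int_part y))).

Lemma e_floor alpha y : e (alpha * IZR (Int_part y)) = (e (alpha * y) * frac_phase alpha y)%C.
Proof. unfold frac_phase. rewrite <- e_plus. f_equal. ring. Qed.

(** Moving y by less than d crosses no integer, so v has floor [Int_part y - k] and the phase is
    Lipschitz along the move. *)
Lemma frac_phase_close alpha y v k d : (forall m, d <= Rabs (y - IZR m)) ->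
  Rabs (y - v - IZR k) < d ->
  Cmod (frac_phase alpha v - frac_phase alpha y) <= 2 * PI * (Rabs alpha * d).
Proof.
  intros Hy Hv. set (m := Int_part y).
  assert (Hm : IZR m <= y < IZR m + 1).
  { unfold m. destruct (base_Int_part y). lra. }
  assert (H1 := Hy m). assert (H2 := Hy (m + 1)%Z). rewrite plus_IZR in H2.
  rewrite Rabs_pos_eq in H1 by lra. rewrite Rabs_left in H2 by lra.
  assert (Hv' := Hv). apply Rabs_def2 in Hv'.
  assert (Hf : Int_part v = (m - k)%Z).
  { symmetry. apply Int_part_spec. rewrite minus_IZR. lra. }
  unfold frac_phase. rewrite Hf. fold m. rewrite minus_IZR.
  eapply Rle_trans; [apply Cmod_e_minus|].
  apply Rmult_le_compat_l; [generalize PI_RGT_0; lra|].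
  replace (_ - _) with (alpha * (y - v - IZR k)) by ring. rewrite Rabs_mult.
  apply Rmult_le_compat_l; [apply Rabs_pos|lra].
Qed.

Definition fejer_mean (J : nat) (phi : R -> C) (y : R) : C :=
  Csum (seq 0 J) (fun l => phi (INR l / INR J)%R * RtoC (fejer J (y - INR l / INR J)))%C.

Lemma fejer_mean_error J phi y : (0 < J)%nat ->
  Cmod (phi y - fejer_mean J phi y) <=
  Rsum (seq 0 J) (fun l => Cmod (phi (INR l / INR J)%R - phi y) * fejer J (y - INR l / INR J)).
Proof.
  intros HJ.
  replace (phi y) with (Csum (seq 0 J) (fun l => phi y * RtoC (fejer J (y - INR l / INR J)))%C) at 1.
  - unfold fejer_mean. rewrite <- Csum_minus. eapply Rle_trans; [apply Cmod_Csum|].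
    apply Rsum_le. intros l _. right.
    rewrite <- (Rabs_pos_eq (fejer J _)) at 3 by apply fejer_ge0.
    rewrite <- Cmod_R, <- Cmod_mult, Cmod_minus_sym. f_equal. ring.
  - rewrite Csum_scal, Csum_RtoC, fejer_partition by easy. ring.
Qed.

(** Away from integers, the sample points within d of y modulo 1 carry nearly the phase of y, while
    at all others the kernel is at most 1/(J d)^2. The bound 2 holds everywhere because the weights
    average phase differences of modulus at most 2. *)
Lemma fejer_mean_approx alpha eta eps : 0 < eta -> 0 < eps -> exists J, (0 < J)%nat /\
  (forall y, Cmod (frac_phase alpha y - fejer_mean J (frac_phase alpha) y) <= 2) /\
  forall y, (forall k, eta <= Rabs (y - IZR k)) ->
    Cmod (frac_phase alpha y - fejer_mean J (frac_phase alpha) y) <= eps.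
Proof.
  intros Heta Heps. set (phi := frac_phase alpha).
  assert (Hphi : forall u v, Cmod (phi u - phi v) <= 2).
  { intros u v. eapply Rle_trans; [apply Cmod_minus_le|]. unfold phi, frac_phase.
    rewrite !Cmod_e. lra. }
  set (B := 2 * PI * Rabs alpha).
  assert (HB : 0 <= B) by (apply Rmult_le_pos; [generalize PI_RGT_0; lra|apply Rabs_pos]).
  set (d := Rmin eta (eps / (2 * (B + 1)))).
  assert (Hd : 0 < d).
  { apply Rmin_glb_lt; [easy|]. apply Rdiv_lt_0_compat; lra. }
  assert (Hd1 : d <= eta) by apply Rmin_l.
  assert (Hd2 : B * d <= eps / 2).
  { apply Rle_trans with ((B + 1) * (eps / (2 * (B + 1)))); [|right; field; lra].
    apply Rmult_le_compat; [lra|lra|lra|apply Rmin_r]. }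
  (* The J far samples cost at most J * 2/(J d)^2 = 2/(J d^2), which is at most eps/2 once 1/J <=
     eps d^2/4. *)
  assert (He' : 0 < eps * d ^ 2 / 4).
  { assert (0 < d ^ 2) by now apply pow_lt. nra. }
  destruct (nat_scale_ex _ He') as [J [HJ HJe]].
  assert (HJ0 : 0 < INR J) by now apply (lt_INR 0).
  exists J. split; [easy|]. split.
  - intros y. eapply Rle_trans; [now apply fejer_mean_error|].
    apply Rle_trans with (Rsum (seq 0 J) (fun l => 2 * fejer J (y - INR l / INR J))).
    + apply Rsum_le. intros l _. apply Rmult_le_compat_r; [apply fejer_ge0|apply Hphi].
    + rewrite Rsum_scal, fejer_partition by easy. lra.
  - intros y Hy. eapply Rle_trans; [now apply fejer_mean_error|].
    apply Rle_trans with (Rsum (seq 0 J) (fun l => B * d * fejer J (y - INR l / INR J)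
      + 2 * / (INR J ^ 2 * d ^ 2))).
    + apply Rsum_le. intros l _.
      assert (Hk := fejer_ge0 J (y - INR l / INR J)).
      assert (Hp : 0 < / (INR J ^ 2 * d ^ 2)).
      { apply Rinv_0_lt_compat, Rmult_lt_0_compat; now apply pow_lt. }
      destruct (classic (exists k, Rabs (y - INR l / INR J - IZR k) < d)) as [[k Hl]|Hl].
      * assert (H := frac_phase_close alpha y (INR l / INR J) k d
          ltac:(intros m; specialize (Hy m); lra) Hl).
        rewrite <- Rmult_assoc in H. fold B phi in H.
        apply Rmult_le_compat_r with (1 := Hk) in H. lra.
      * assert (H : fejer J (y - INR l / INR J) <= / (INR J ^ 2 * d ^ 2)).
        { apply fejer_far; [easy|easy|]. intros k. apply Rnot_lt_le. intros H. apply Hl. now exists k. }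
        assert (0 <= B * d * fejer J (y - INR l / INR J)).
        { apply Rmult_le_pos; [apply Rmult_le_pos; lra|easy]. }
        assert (Cmod (phi (INR l / INR J)%R - phi y) * fejer J (y - INR l / INR J)
                <= 2 * / (INR J ^ 2 * d ^ 2)).
        { apply Rmult_le_compat; [apply Cmod_ge_0|easy|apply Hphi|easy]. }
        lra.
    + rewrite Rsum_plus, Rsum_scal, Rsum_const, length_seq, fejer_partition by easy.
      assert (INR J * (2 * / (INR J ^ 2 * d ^ 2)) <= eps / 2); [|lra].
      replace (INR J * (2 * / (INR J ^ 2 * d ^ 2))) with (/ INR J * (2 / d ^ 2)) by (field; lra).
      apply Rle_trans with (eps * d ^ 2 / 4 * (2 / d ^ 2)); [|right; field; lra].
      apply Rmult_le_compat_r; [|easy]. left. apply Rdiv_lt_0_compat; [lra|now apply pow_lt].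
Qed.

(** * Few points near integers, from cancellation in exponential sums *)

Definition near_integer (eta y : R) : Prop := exists k : Z, Rabs (y - IZR k) < eta.

(** Each of the J terms is within 2 pi/16 <= 1/2 of 1, by pi <= 4; hence the constant 16. *)
Lemma dirichlet_near J y : (0 < J)%nat -> near_integer (/ (16 * INR J)) y ->
  INR J / 2 <= Cmod (dirichlet J y).
Proof.
  intros HJ [k Hk]. assert (HJ0 : 0 < INR J) by now apply (lt_INR 0).
  set (r := y - IZR k) in *.
  assert (H : Cmod (RtoC (INR J) - dirichlet J y) <= INR J / 2).
  { replace (RtoC (INR J)) with (Csum (seq 0 J) (fun _ => RtoC 1))
      by (rewrite Csum_RtoC, Rsum_const, length_seq, Rmult_1_r; easy).
    unfold dirichlet. rewrite <- Csum_minus. eapply Rle_trans; [apply Cmod_Csum|].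
    apply Rle_trans with (Rsum (seq 0 J) (fun _ => / 2)); [|rewrite Rsum_const, length_seq; lra].
    apply Rsum_le. intros j Hj. apply in_seq in Hj.
    replace (INR j * y) with (INR j * r + IZR (Z.of_nat j * k))
      by (rewrite mult_IZR, <- INR_IZR_INZ; unfold r; ring).
    rewrite e_plus_Z, <- e_0. eapply Rle_trans; [apply Cmod_e_minus|].
    rewrite Rminus_0_l, Rabs_Ropp, Rabs_mult, (Rabs_pos_eq (INR j)) by apply pos_INR.
    assert (INR j * Rabs r <= / 16).
    { apply Rle_trans with (INR J * / (16 * INR J)); [|right; field; lra].
      apply Rmult_le_compat; [apply pos_INR|apply Rabs_pos|apply le_INR; lia|lra]. }
    generalize PI_4 PI_RGT_0 (Rmult_le_pos _ _ (pos_INR j) (Rabs_pos r)). nra. }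
  generalize (Cmod_triangle (RtoC (INR J) - dirichlet J y) (dirichlet J y)).
  replace (RtoC (INR J) - dirichlet J y + dirichlet J y)%C with (RtoC (INR J)) by ring.
  rewrite Cmod_R, Rabs_pos_eq by lra. lra.
Qed.

(** Chebyshev's inequality for |D_J(x_n)|^2, D_J being [dirichlet J]: its mean is at most J + o(1)
    by almost orthogonality of the harmonics, whereas it is at least J^2/4 near integers. The
    proportion of such n is thus at most 4/J + o(1). *)
Lemma near_integer_count (x : nat -> R) :
  (forall theta, theta <> 0 -> sublinear (fun N => Cmod (Csum (seq 1 N) (fun n => e (theta * x n))))) ->
  forall eps, 0 < eps -> exists eta, 0 < eta /\ eventually (fun N =>
    Rsum (seq 1 N) (fun n => if excluded_middle_informative (near_integer eta (x n)) then 1 else 0)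
    <= eps * INR N).
Proof.
  intros Hx eps He. assert (He8 : 0 < eps / 8) by lra.
  destruct (nat_scale_ex _ He8) as [J [HJ HJe]].
  assert (HJ0 : 0 < INR J) by now apply (lt_INR 0).
  assert (HO := almost_orthogonal (seq 0 J) (fun _ j n => e (INR j * x n)) (fun _ => 1)
    (seq_NoDup _ _)).
  rewrite Rsum_const, length_seq in HO.
  assert (HO' : sublinear (fun N => Rsum (seq 1 N) (fun n => Cmod (dirichlet J (x n)) ^ 2)
    - INR J * 1 * INR N)).
  { apply HO.
    - intros i _ N. apply (Rsum_Cmod_sqr_le_INR (fun n => e (INR i * x n))).
      intros n. rewrite Cmod_e. lra.
    - intros i j _ _ Hij. apply lt_INR in Hij.
      apply sublinear_le with (2 := Hx (INR i - INR j) ltac:(lra)).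
      intros N. right. f_equal. apply Csum_ext. intros n _.
      rewrite Cconj_e, <- e_plus. f_equal. ring. }
  set (k := 4 * / INR J ^ 2).
  assert (Hk : 0 < k) by (apply Rmult_lt_0_compat; [lra|now apply Rinv_0_lt_compat, pow_lt]).
  destruct (sublinear_scal k _ (Rlt_le _ _ Hk) HO' (eps / 2) ltac:(lra)) as [N0 H0].
  exists (/ (16 * INR J)). split; [apply Rinv_0_lt_compat; lra|].
  exists N0. intros N HN. specialize (H0 N HN). cbv beta in H0.
  apply Rle_trans with (Rsum (seq 1 N) (fun n => k * Cmod (dirichlet J (x n)) ^ 2)).
  - apply Rsum_le. intros n _.
    destruct (excluded_middle_informative (near_integer (/ (16 * INR J)) (x n))) as [H|_].
    + apply (dirichlet_near J (x n) HJ) in H.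
      apply Rle_trans with (k * (INR J / 2) ^ 2); [right; unfold k; field; lra|].
      apply Rmult_le_compat_l; [lra|]. apply pow_incr. lra.
    + apply Rmult_le_pos; [lra|apply pow2_ge_0].
  - rewrite Rsum_scal. set (Q := Rsum _ _) in *.
    assert (H1 : k * (Q - INR J * 1 * INR N) = k * Q - 4 * / INR J * INR N) by (unfold k; field; lra).
    assert (H2 := Rmult_le_compat_r _ _ _ (pos_INR N) HJe). clearbody Q. lra.
Qed.

(** * Twisted sums *)

(** With the test function [W] isolated the condition passes to linear combinations, which reduces a
    trigonometric polynomial to single harmonics. *)
Definition negligible (g : nat -> C) (x : nat -> R) (W : R -> C) : Prop :=
  sublinear (fun N => Cmod (Csum (seq 1 N) (fun n => g n * W (x n))%C)).

Lemma negligible_ext g x W W' : (forall y, W y = W' y) -> negligible g x W -> negligible g x W'.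
Proof.
  intros H. apply sublinear_le. intros N. right. f_equal. apply Csum_ext.
  intros n _. now rewrite H.
Qed.

Lemma negligible_scal g x k W : negligible g x W -> negligible g x (fun y => k * W y)%C.
Proof.
  intros H. apply sublinear_le with (2 := sublinear_scal (Cmod k) _ (Cmod_ge_0 k) H).
  intros N. right. rewrite <- Cmod_mult, <- Csum_scal. f_equal. apply Csum_ext. intros n _. ring.
Qed.

Lemma negligible_Csum {A} g x (l : list A) W :
  (forall a, In a l -> negligible g x (W a)) -> negligible g x (fun y => Csum l (fun a => W a y)).
Proof.
  intros H. apply sublinear_le with (2 := sublinear_Rsum l _ H).
  intros N. eapply Rle_trans; [|apply Cmod_Csum]. right. f_equal.
  rewrite <- Csum_switch. apply Csum_ext. intros n _. now rewrite Csum_scal.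
Qed.

(** Expanding the kernel leaves only the integer frequencies i - j; the translation by l/J becomes a
    constant factor. *)
Lemma negligible_fejer_mean g x J phi :
  (forall k, negligible g x (fun y => e (IZR k * y))) -> negligible g x (fejer_mean J phi).
Proof.
  intros H. apply negligible_Csum. intros l _. apply negligible_scal.
  apply negligible_ext with (1 := fun y => eq_sym (fejer_expand J (y - INR l / INR J))).
  apply negligible_Csum. intros i _. apply negligible_Csum. intros j _. apply negligible_scal.
  apply negligible_ext with (fun y => e (- (INR i - INR j) * (INR l / INR J)) *
    e (IZR (Z.of_nat i - Z.of_nat j) * y))%C; [|apply negligible_scal, H].
  intros y. rewrite <- e_plus, minus_IZR, <- !INR_IZR_INZ. f_equal. ring.
Qed.

Lemma twisted_floor_sum (c : R) (f : nat -> C) (alpha : R) :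
  0 < c -> ~ is_integer c -> multiplicative f -> (forall n, Cmod (f n) <= 1) ->
  ~ is_integer alpha ->
  sublinear (fun N => Cmod (Csum (seq 1 N)
    (fun n => f n * e (alpha * IZR (Int_part (Rpower (INR n) c))))%C)).
Proof.
  intros Hc0 Hc Hm Hf Ha eps He. set (x := fun n => Rpower (INR n) c).
  set (g := fun n => (f n * e (alpha * x n))%C).
  assert (Hg : forall n, Cmod (g n) <= 1).
  { intros n. unfold g. rewrite Cmod_mult, Cmod_e, Rmult_1_r. apply Hf. }
  (* Shares of the error: eps/4 for the Fejer mean, 2 * eps/8 for points near integers, eps/4 for
     all other points. *)
  assert (He8 : 0 < eps / 8) by lra. assert (He4 : 0 < eps / 4) by lra.
  destruct (near_integer_count x (fun theta Ht => power_exponential_sum theta c Ht Hc0 Hc) _ He8)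
    as (eta & Heta & H1).
  destruct (fejer_mean_approx alpha eta _ Heta He4) as (J & HJ & H2 & H3).
  set (T := fejer_mean J (frac_phase alpha)) in *.
  assert (H4 : negligible g x T).
  { apply negligible_fejer_mean. intros k.
    apply sublinear_le with (2 := katai_power f (alpha + IZR k) c Hm Hf
      ltac:(intros H; apply Ha; exists (- k)%Z; rewrite opp_IZR; lra) Hc0 Hc).
    intros N. right. f_equal. apply Csum_ext. intros n _. unfold g.
    rewrite Rmult_plus_distr_r, e_plus. unfold x. ring. }
  generalize (filter_and _ _ H1 (H4 _ He4)). apply filter_imp. intros N [H5 H6].
  rewrite (Csum_ext _ _ (fun n => g n * T (x n) + g n * (frac_phase alpha (x n) - T (x n)))%C)
    by (intros n _; fold (x n); rewrite e_floor; unfold g; ring).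
  rewrite Csum_plus. eapply Rle_trans; [apply Cmod_triangle|].
  assert (H7 : Cmod (Csum (seq 1 N) (fun n => g n * (frac_phase alpha (x n) - T (x n)))%C) <=
    2 * (eps / 8 * INR N) + INR N * (eps / 4)).
  2:{ eapply Rle_trans; [exact (Rplus_le_compat _ _ _ _ H6 H7)|].
      generalize (Rmult_le_pos _ _ (Rlt_le _ _ He) (pos_INR N)). lra. }
  eapply Rle_trans; [apply Cmod_Csum|].
  apply Rle_trans with (Rsum (seq 1 N) (fun n => 2 * (if excluded_middle_informative
    (near_integer eta (x n)) then 1 else 0) + eps / 4)).
  - apply Rsum_le. intros n _. rewrite Cmod_mult.
    apply Rle_trans with (1 * Cmod (frac_phase alpha (x n) - T (x n))).
    + apply Rmult_le_compat_r; [apply Cmod_ge_0|apply Hg].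
    + destruct (excluded_middle_informative (near_integer eta (x n))) as [_|H].
      * specialize (H2 (x n)). lra.
      * assert (H' := H3 (x n)). rewrite Rmult_1_l, Rmult_0_r, Rplus_0_l. apply H'.
        intros k. apply Rnot_lt_le. intros Hk. apply H. now exists k.
  - rewrite Rsum_plus, Rsum_scal, Rsum_const, length_seq. lra.
Qed.

(** * Return to the sum of the theorem *)

Lemma sum_n_m_Csum (a : nat -> C) M : sum_n_m a 1 M = Csum (seq 1 M) a.
Proof.
  induction M as [|M IH]; [apply (sum_n_m_zero a 1 0); lia|].
  rewrite sum_n_Sm, Csum_seq_S, IH by lia. easy.
Qed.

Theorem theorem8 (c : R) (hc1 : 1 < c) (hc : ~ is_integer c) :
  forall (f : nat -> C), multiplicative f ->
  (forall n : nat, Cmod (f n) <= 1) ->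
  forall alpha : R, is_rational alpha -> ~ is_integer alpha ->
  is_lim_seq (fun N : nat => Cmod (S f alpha c N) / INR N) 0.
Proof.
  intros f Hm Hf alpha _ Ha. apply is_lim_seq_spec. intros [eps He]. simpl.
  assert (Hc0 : 0 < c) by lra. assert (He2 : 0 < eps / 2) by lra.
  destruct (twisted_floor_sum c f alpha Hc0 hc Hm Hf Ha _ He2) as [N0 H0].
  (* The sum runs over n < N, so the bound is used at N - 1; taking eps/2 makes the final inequality
     strict. *)
  exists (Datatypes.S N0). intros N HN. specialize (H0 (N - 1)%nat ltac:(lia)).
  assert (HN0 : 0 < INR N) by (apply (lt_INR 0); lia).
  assert (HN1 : INR (N - 1) <= INR N) by (apply le_INR; lia).
  unfold S. rewrite sum_n_m_Csum, Rminus_0_r, Rabs_pos_eq.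
  - apply Rmult_lt_reg_r with (INR N); [easy|]. unfold Rdiv.
    rewrite Rmult_assoc, Rinv_l, Rmult_1_r by lra. apply Rle_lt_trans with (1 := H0). nra.
  - apply Rdiv_le_0_compat; [apply Cmod_ge_0|easy].
Qed.
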